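(* Let $\mathcal{C}$ be a category with kernel pairs and split pullbacks. The following are equivalent: (i) the forgetful functor $U_{123}\colon \mathsf{Grpd}(\mathcal{C}) \to \mathsf{RG}(\mathcal{C})$ is an isomorphism; (ii) the forgetful functor $U_{12}\colon \mathsf{Cat}(\mathcal{C}) \to \mathsf{RG}(\mathcal{C})$ has a section; (iii) the forgetful functor $U_{1}\colon \mathsf{MG}(\mathcal{C}) \to \mathsf{RG}(\mathcal{C})$ has a section; (iv) the forgetful functor $V\colon \mathsf{PreGrpd}(\mathcal{C}) \to \mathsf{Span}(\mathcal{C})$ has a section; (v) for all morphisms $f\colon A\to B$, $r\colon B\to A$, $g\colon C\to B$, $s\colon B\to C$, $\alpha\colon A\to D$, $\beta\colon B\to D$, $\gamma\colon C\to D$ in $\mathcal{C}$ with $fr=1_B=gs$ and $\alpha r=\beta=\gamma s$, and for every span $D_0\xleftarrow{d} D\xrightarrow{c} D_0'$ in $\mathcal{C}$ such that $d\alpha=d\beta f$ and $c\gamma=c\beta g$, there is a unique morphism $\varphi\colon A\times_B C\to D$ such that $$\varphi e_1=\alpha,\quad \varphi e_2=\gamma,\quad d\varphi=d\gamma\pi_2,\quad c\varphi=c\alpha\pi_1,$$ where $A\times_B C$ is the pullback of $f$ and $g$ with projections $\pi_1\colon A\times_BC\to A$, $\pi_2\colon A\times_BC\to C$, and $e_1=\langle 1_A, sf\rangle\colon A\to A\times_B C$, $e_2=\langle rg,1_C\rangle\colon C\to A\times_B C$. If these equivalent conditions hold, then the functors $U_{12}$, $U_1$ and $V$ are also isomorphisms.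 Furthermore, any pregroupoid in $\mathcal{C}$ is then associative.
   Context: A category $\mathcal{C}$ has kernel pairs if the pullback of any morphism along itself exists; it has split pullbacks if the pullback of a split epimorphism along a split epimorphism always exists. No binary products are assumed. $\langle\cdot,\cdot\rangle$ denotes a morphism induced into a pullback. A section of a functor $U$ is a functor $S$ with $US=1$. A reflexive graph in $\mathcal{C}$ consists of morphisms $d,c\colon C_1\to C_0$, $e\colon C_0\to C_1$ with $de=1_{C_0}=ce$. A multiplicative graph is a reflexive graph together with $m\colon C_2\to C_1$, where $C_2=C_1\times_{C_0}C_1$ is the pullback of $d$ and $c$, with projections $\pi_1,\pi_2\colon C_2\to C_1$, $d\pi_1=c\pi_2$, such that $me_1=1_{C_1}=me_2$, $dm=d\pi_2$, $cm=c\pi_1$, where $e_1=\langle 1_{C_1},ed\rangle$, $e_2=\langle ec,1_{C_1}\rangle\colon C_1\to C_2$. (Pullbacks are regarded as chosen, so that a multiplicative graph is a reflexive graph with the extra structure $m$.) An internal category is a multiplicative graph satisfying $m(1\times m)=m(m\times 1)$. An internal groupoid is an internal category for which there is a morphism $t\colon C_1\to C_1$ with $ct=d$, $dt=c$, $m\langle 1_{C_1},t\rangle=ec$ and $m\langle t,1_{C_1}\rangle=ed$. $\mathsf{RG}(\mathcal{C})$ is the category of reflexive graphs (morphisms are pairs $(f_1,f_0)$ commuting with $d,c,e$); $\mathsf{MG}(\mathcal{C})$, $\mathsf{Cat}(\mathcal{C})$, $\mathsf{Grpd}(\mathcal{C})$ are the categories of multiplicative graphs, internal categories and internal groupoids (morphisms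 are morphisms of reflexive graphs that also commute with $m$). There are forgetful functors $U_3\colon\mathsf{Grpd}(\mathcal{C})\to\mathsf{Cat}(\mathcal{C})$, $U_2\colon\mathsf{Cat}(\mathcal{C})\to\mathsf{MG}(\mathcal{C})$, $U_1\colon\mathsf{MG}(\mathcal{C})\to\mathsf{RG}(\mathcal{C})$, and $U_{12}=U_1U_2$, $U_{123}=U_1U_2U_3$. $\mathsf{Span}(\mathcal{C})$ is the category of spans $D_0\xleftarrow{d}D\xrightarrow{c}D_0'$ (morphisms are triples of morphisms between the respective objects making the two evident squares commute). Given a span $(d,c)$, let $D\times_{D_0}D$ be the kernel pair of $d$ with projections $d_1,d_2$, let $D\times_{D_0'}D$ be the kernel pair of $c$ with projections $c_1,c_2$, and let $D\times_{D_0}D\times_{D_0'}D$ be the pullback of $d_2$ and $c_1$, with projections $p_1$ to $D\times_{D_0}D$ and $p_2$ to $D\times_{D_0'}D$; its generalised elements are triples $(x,y,z)$ with $dx=dy$ and $cy=cz$. Let $i_1\colon D\times_{D_0}D\to D\times_{D_0}D\times_{D_0'}D$ be determined by $p_1i_1=1$, $p_2i_1=\langle d_2,d_2\rangle$, and $i_2\colon D\times_{D_0'}D\to D\times_{D_0}D\times_{D_0'}D$ by $p_2i_2=1$, $p_1i_2=\langle c_1,c_1\rangle$. A pregroupoid is a span $(d,c)$ together with a morphism $p\colon D\times_{D_0}D\times_{D_0'}D\to D$ such that $pi_1=d_1$, $pi_2=c_2$, $dp=dc_2p_2$ and $cp=cd_1p_1$; in terms of elements, $p(x,y,y)=x$,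 $p(x,x,y)=y$, $dp(x,y,z)=dz$, $cp(x,y,z)=cx$. Associativity is not part of this definition: a pregroupoid is called associative when $p(p(x,y,z),u,v)=p(x,y,p(z,u,v))$ whenever both sides make sense. $\mathsf{PreGrpd}(\mathcal{C})$ is the category of pregroupoids (morphisms are span morphisms commuting with $p$) and $V$ is the forgetful functor. *)

(* Defs.v *)
From Stdlib Require Import ssreflect ProofIrrelevance.

Set Implicit Arguments.
Unset Strict Implicit.
Unset Printing Implicit Defensive.

Declare Scope cat_scope.
Delimit Scope cat_scope with cat.
Local Open Scope cat_scope.

Record Category : Type := MkCategory {
  Ob :> Type;
  Hom : Ob -> Ob -> Type;
  idm : forall A, Hom A A;
  comp : forall A B C, Hom B C -> Hom A B -> Hom A C;
  compA : forall A B C D (h : Hom C D) (g : Hom B C) (f : Hom A B),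
    comp h (comp g f) = comp (comp h g) f;
  comp1m : forall A B (f : Hom A B), comp (idm B) f = f;
  compm1 : forall A B (f : Hom A B), comp f (idm A) = f }.

Arguments Hom {c} A B.
Arguments idm {c} A.
Arguments comp {c A B C} g f.
Arguments compA {c A B C D} h g f.
Arguments comp1m {c A B} f.
Arguments compm1 {c A B} f.

Notation "g ∘ f" := (comp g f) (at level 40, left associativity) : cat_scope.

Record Functor (C D : Category) : Type := MkFunctor {
  fobj :> C -> D;
  fmap : forall A B : C, Hom A B -> Hom (fobj A) (fobj B);
  fmap1 : forall A : C, fmap (idm A) = idm (fobj A);
  fmapM : forall (A B E : C) (g : Hom B E) (f : Hom A B),
    fmap (g ∘ f) = fmap g ∘ fmap f }.

Arguments fmap {C D} _ {A B} _.

Definition functor_id (C : Category) : Functor C C :=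
  @MkFunctor C C (fun A => A) (fun A B f => f)
    (fun A => eq_refl) (fun A B E g f => eq_refl).

Lemma functor_comp_fmap1 (C D E : Category) (G : Functor D E) (F : Functor C D)
  (A : C) : fmap G (fmap F (idm A)) = idm (G (F A)).
Proof. by rewrite !fmap1. Qed.

Lemma functor_comp_fmapM (C D E : Category) (G : Functor D E) (F : Functor C D)
  (X Y Z : C) (g : Hom Y Z) (f : Hom X Y) :
  fmap G (fmap F (g ∘ f)) = fmap G (fmap F g) ∘ fmap G (fmap F f).
Proof. by rewrite !fmapM. Qed.

Definition functor_comp (C D E : Category) (G : Functor D E) (F : Functor C D) :
  Functor C E :=
  @MkFunctor C E (fun A => G (F A)) (fun A B f => fmap G (fmap F f))
    (functor_comp_fmap1 G F) (@functor_comp_fmapM C D E G F).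

(** Equality of functors is strict: Leibniz equality of the records, that is
    (up to proof irrelevance) equality on objects and on morphisms. *)
Definition has_section (C D : Category) (U : Functor C D) : Prop :=
  exists S : Functor D C, functor_comp U S = functor_id D.

Definition is_isomorphism (C D : Category) (U : Functor C D) : Prop :=
  exists S : Functor D C,
    functor_comp U S = functor_id D /\ functor_comp S U = functor_id C.

Lemma sig_eq (T : Type) (P : T -> Prop) (u v : {x | P x}) :
  proj1_sig u = proj1_sig v -> u = v.
Proof.
case: u v => [x hx] [y hy] /= exy; subst y.
by rewrite (proof_irrelevance _ hx hy).
Qed.

Section OverCat.

Context (B : Category) (X : Type) (u : X -> B)
  (P : forall x y : X, Hom (u x) (u y) -> Prop)
  (P1 : forall x, P x x (idm (u x)))
  (PM : forall x y z (g : Hom (u y) (u z)) (f : Hom (u x) (u y)),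
    P y z g -> P x y f -> P x z (g ∘ f)).

Definition over_hom (x y : X) : Type := {f : Hom (u x) (u y) | P f}.

Definition over_id (x : X) : over_hom x x := exist _ (idm (u x)) (P1 x).

Definition over_comp (x y z : X) (g : over_hom y z) (f : over_hom x y) :
  over_hom x z :=
  exist _ (proj1_sig g ∘ proj1_sig f) (PM (proj2_sig g) (proj2_sig f)).

Definition OverCat : Category.
Proof.
refine (@MkCategory X over_hom over_id over_comp _ _ _).
- by move=> *; apply: sig_eq; rewrite /= compA.
- by move=> *; apply: sig_eq; rewrite /= comp1m.
- by move=> *; apply: sig_eq; rewrite /= compm1.
Defined.

Definition over_forget : Functor OverCat B :=
  @MkFunctor OverCat B u (fun x y f => proj1_sig f)
    (fun x => eq_refl) (fun x y z g f => eq_refl).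

End OverCat.

Definition FullSub (B : Category) (P : B -> Prop) : Category :=
  @MkCategory {x : B | P x}
    (fun x y => Hom (proj1_sig x) (proj1_sig y))
    (fun x => idm (proj1_sig x))
    (fun x y z g f => g ∘ f)
    (fun x y z t h g f => compA h g f)
    (fun x y f => comp1m f)
    (fun x y f => compm1 f).

Definition full_inclusion (B : Category) (P : B -> Prop) :
  Functor (FullSub P) B :=
  @MkFunctor (FullSub P) B (@proj1_sig B P) (fun x y f => f)
    (fun x => eq_refl) (fun x y z g f => eq_refl).

Record Pullback (CC : Category) (A B C : CC) (f : Hom A C) (g : Hom B C) : Type :=
  MkPullback {
  pb_obj :> CC;
  pb1 : Hom pb_obj A;
  pb2 : Hom pb_obj B;
  pb_comm : f ∘ pb1 = g ∘ pb2;
  pb_pair : forall (T : CC) (x : Hom T A) (y : Hom T B),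
    f ∘ x = g ∘ y -> Hom T pb_obj;
  pb1_pair : forall (T : CC) (x : Hom T A) (y : Hom T B) (h : f ∘ x = g ∘ y),
    pb1 ∘ pb_pair h = x;
  pb2_pair : forall (T : CC) (x : Hom T A) (y : Hom T B) (h : f ∘ x = g ∘ y),
    pb2 ∘ pb_pair h = y;
  pb_ext : forall (T : CC) (w w' : Hom T pb_obj),
    pb1 ∘ w = pb1 ∘ w' -> pb2 ∘ w = pb2 ∘ w' -> w = w' }.

Arguments pb1 {CC A B C f g} p.
Arguments pb2 {CC A B C f g} p.
Arguments pb_comm {CC A B C f g} p.
Arguments pb_pair {CC A B C f g} p {T} x y h.

Definition split_epi (CC : Category) (A B : CC) (f : Hom A B) : Prop :=
  exists s : Hom B A, f ∘ s = idm B.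

Lemma split_epi_intro (CC : Category) (A B : CC) (f : Hom A B) (s : Hom B A) :
  f ∘ s = idm B -> split_epi f.
Proof. by exists s. Qed.

(** Both notions carry a choice of pullbacks; no compatibility between the two
    choices is required. *)
Definition has_kernel_pairs (CC : Category) : Type :=
  forall (A B : CC) (f : Hom A B), Pullback f f.

Definition has_split_pullbacks (CC : Category) : Type :=
  forall (A B C : CC) (f : Hom A C) (g : Hom B C),
    split_epi f -> split_epi g -> Pullback f g.

Arguments has_kernel_pairs : clear implicits.
Arguments has_split_pullbacks : clear implicits.

Lemma pb_in1_comm (CC : Category) (A B C : CC) (f : Hom A B) (g : Hom C B)
  (s : Hom B C) : g ∘ s = idm B -> f ∘ idm A = g ∘ (s ∘ f).
Proof. by move=> h; rewrite compA h comp1m compm1. Qed.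

Lemma pb_in2_comm (CC : Category) (A B C : CC) (f : Hom A B) (g : Hom C B)
  (r : Hom B A) : f ∘ r = idm B -> f ∘ (r ∘ g) = g ∘ idm C.
Proof. by move=> h; rewrite compA h comp1m compm1. Qed.

(** With [f = d], [g = c] and [r = s = e] for a reflexive graph, these are also the
    morphisms [e_1] and [e_2] in the unit laws of a multiplicative graph. *)
Definition pb_in1 (CC : Category) (A B C : CC) (f : Hom A B) (g : Hom C B)
  (P : Pullback f g) (s : Hom B C) (hs : g ∘ s = idm B) : Hom A P :=
  pb_pair P (idm A) (s ∘ f) (pb_in1_comm f hs).

Definition pb_in2 (CC : Category) (A B C : CC) (f : Hom A B) (g : Hom C B)
  (P : Pullback f g) (r : Hom B A) (hr : f ∘ r = idm B) : Hom C P :=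
  pb_pair P (r ∘ g) (idm C) (pb_in2_comm g hr).

Lemma pb_map_comm (CC : Category) (A B C A' B' C' : CC)
  (f : Hom A C) (g : Hom B C) (f' : Hom A' C') (g' : Hom B' C')
  (P : Pullback f g) (a : Hom A A') (b : Hom B B') (c : Hom C C') :
  f' ∘ a = c ∘ f -> g' ∘ b = c ∘ g -> f' ∘ (a ∘ pb1 P) = g' ∘ (b ∘ pb2 P).
Proof. by move=> ha hb; rewrite !compA ha hb -!compA pb_comm. Qed.

Definition pb_map (CC : Category) (A B C A' B' C' : CC)
  (f : Hom A C) (g : Hom B C) (f' : Hom A' C') (g' : Hom B' C')
  (P : Pullback f g) (P' : Pullback f' g')
  (a : Hom A A') (b : Hom B B') (c : Hom C C')
  (ha : f' ∘ a = c ∘ f) (hb : g' ∘ b = c ∘ g) : Hom P P' :=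
  pb_pair P' (a ∘ pb1 P) (b ∘ pb2 P) (pb_map_comm P ha hb).

Arguments pb_map {CC A B C A' B' C' f g f' g'} P P' a b c ha hb.

Lemma pb_map_id (CC : Category) (A B C : CC) (f : Hom A C) (g : Hom B C)
  (P : Pullback f g) (a : Hom A A) (b : Hom B B) (c : Hom C C) ha hb :
  a = idm A -> b = idm B -> pb_map P P a b c ha hb = idm P.
Proof.
move=> ea eb; subst a b.
by apply: pb_ext; rewrite /pb_map ?pb1_pair ?pb2_pair compm1 comp1m.
Qed.

Lemma pb_map_comp (CC : Category) (A B C A' B' C' A'' B'' C'' : CC)
  (f : Hom A C) (g : Hom B C) (f' : Hom A' C') (g' : Hom B' C')
  (f'' : Hom A'' C'') (g'' : Hom B'' C'')
  (P : Pullback f g) (P' : Pullback f' g') (P'' : Pullback f'' g'')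
  a b c ha hb a' b' c' ha' hb' a'' b'' c'' ha'' hb'' :
  a'' = a' ∘ a -> b'' = b' ∘ b ->
  pb_map P P'' a'' b'' c'' ha'' hb'' =
  pb_map P' P'' a' b' c' ha' hb' ∘ pb_map P P' a b c ha hb.
Proof.
move=> ea eb; subst a'' b''; apply: pb_ext.
- by rewrite /pb_map pb1_pair [RHS]compA pb1_pair -[RHS]compA pb1_pair compA.
- by rewrite /pb_map pb2_pair [RHS]compA pb2_pair -[RHS]compA pb2_pair compA.
Qed.

Record ReflGraph (CC : Category) : Type := MkReflGraph {
  rg1 : CC;
  rg0 : CC;
  rg_d : Hom rg1 rg0;
  rg_c : Hom rg1 rg0;
  rg_e : Hom rg0 rg1;
  rg_de : rg_d ∘ rg_e = idm rg0;
  rg_ce : rg_c ∘ rg_e = idm rg0 }.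

Record RGHom (CC : Category) (G H : ReflGraph CC) : Type := MkRGHom {
  rgh1 : Hom (rg1 G) (rg1 H);
  rgh0 : Hom (rg0 G) (rg0 H);
  rgh_d : rg_d H ∘ rgh1 = rgh0 ∘ rg_d G;
  rgh_c : rg_c H ∘ rgh1 = rgh0 ∘ rg_c G;
  rgh_e : rgh1 ∘ rg_e G = rg_e H ∘ rgh0 }.

Lemma RGHom_eq (CC : Category) (G H : ReflGraph CC) (f g : RGHom G H) :
  rgh1 f = rgh1 g -> rgh0 f = rgh0 g -> f = g.
Proof.
case: f g => [f1 f0 a b c] [g1 g0 a' b' c'] /= e1 e0; subst g1 g0.
by f_equal; apply: proof_irrelevance.
Qed.

Definition RGHom_id (CC : Category) (G : ReflGraph CC) : RGHom G G.
Proof. by exists (idm _) (idm _); rewrite comp1m compm1. Defined.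

Definition RGHom_comp (CC : Category) (G H K : ReflGraph CC)
  (g : RGHom H K) (f : RGHom G H) : RGHom G K.
Proof.
exists (rgh1 g ∘ rgh1 f) (rgh0 g ∘ rgh0 f).
- by rewrite compA rgh_d -compA rgh_d compA.
- by rewrite compA rgh_c -compA rgh_c compA.
- by rewrite -compA rgh_e compA rgh_e compA.
Defined.

Definition RG (CC : Category) : Category.
Proof.
refine (@MkCategory (ReflGraph CC) (@RGHom CC) (@RGHom_id CC) (@RGHom_comp CC) _ _ _).
- by move=> *; apply: RGHom_eq; rewrite /= compA.
- by move=> *; apply: RGHom_eq; rewrite /= comp1m.
- by move=> *; apply: RGHom_eq; rewrite /= compm1.
Defined.

Definition composable (CC : Category) (sp : has_split_pullbacks CC)
  (G : ReflGraph CC) : Pullback (rg_d G) (rg_c G) :=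
  sp _ _ _ (rg_d G) (rg_c G)
    (split_epi_intro (rg_de G)) (split_epi_intro (rg_ce G)).

Record MultGraph (CC : Category) (sp : has_split_pullbacks CC) : Type :=
  MkMultGraph {
  mg_graph :> ReflGraph CC;
  mg_m : Hom (composable sp mg_graph) (rg1 mg_graph);
  mg_e1 : mg_m ∘ pb_in1 (composable sp mg_graph) (rg_ce mg_graph)
          = idm (rg1 mg_graph);
  mg_e2 : mg_m ∘ pb_in2 (composable sp mg_graph) (rg_de mg_graph)
          = idm (rg1 mg_graph);
  mg_dm : rg_d mg_graph ∘ mg_m = rg_d mg_graph ∘ pb2 (composable sp mg_graph);
  mg_cm : rg_c mg_graph ∘ mg_m = rg_c mg_graph ∘ pb1 (composable sp mg_graph) }.

Definition preserves_mult (CC : Category) (sp : has_split_pullbacks CC)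
  (X Y : MultGraph sp) (f : RGHom X Y) : Prop :=
  rgh1 f ∘ mg_m X =
  mg_m Y ∘ pb_map (composable sp X) (composable sp Y)
             (rgh1 f) (rgh1 f) (rgh0 f) (rgh_d f) (rgh_c f).

Lemma preserves_mult_id (CC : Category) (sp : has_split_pullbacks CC)
  (X : MultGraph sp) : preserves_mult (idm (mg_graph X : RG CC)).
Proof. by rewrite /preserves_mult pb_map_id // comp1m compm1. Qed.

Lemma preserves_mult_comp (CC : Category) (sp : has_split_pullbacks CC)
  (X Y Z : MultGraph sp)
  (g : @Hom (RG CC) Y Z) (f : @Hom (RG CC) X Y) :
  preserves_mult g -> preserves_mult f -> preserves_mult (g ∘ f).
Proof.
rewrite /preserves_mult => hg hf.
rewrite (pb_map_comp _ (composable sp Y) _ (rgh_d f) (rgh_c f) (rgh_d g) (rgh_c g)) //.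
by rewrite compA -hg /= -!compA hf.
Qed.

Definition MG (CC : Category) (sp : has_split_pullbacks CC) : Category :=
  @OverCat (RG CC) (MultGraph sp) (@mg_graph CC sp) (@preserves_mult CC sp)
    (@preserves_mult_id CC sp) (@preserves_mult_comp CC sp).

Definition U1 (CC : Category) (sp : has_split_pullbacks CC) :
  Functor (MG sp) (RG CC) :=
  @over_forget (RG CC) (MultGraph sp) (@mg_graph CC sp) (@preserves_mult CC sp)
    (@preserves_mult_id CC sp) (@preserves_mult_comp CC sp).

Lemma composable_pb1_split (CC : Category) (sp : has_split_pullbacks CC)
  (G : ReflGraph CC) : split_epi (pb1 (composable sp G)).
Proof. exists (pb_in1 _ (rg_ce G)); exact: pb1_pair. Qed.

Lemma composable_pb2_split (CC : Category) (sp : has_split_pullbacks CC)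
  (G : ReflGraph CC) : split_epi (pb2 (composable sp G)).
Proof. exists (pb_in2 _ (rg_de G)); exact: pb2_pair. Qed.

(** The object of composable triples [(x, y, z)] is encoded as that of pairs
    [((x, y), (y, z))], so that only pullbacks of split epimorphisms are used. *)
Definition composable3 (CC : Category) (sp : has_split_pullbacks CC)
  (G : ReflGraph CC) : Pullback (pb2 (composable sp G)) (pb1 (composable sp G)) :=
  sp _ _ _ _ _ (composable_pb2_split sp G) (composable_pb1_split sp G).

Lemma one_times_m_comm (CC : Category) (sp : has_split_pullbacks CC)
  (X : MultGraph sp) :
  rg_d X ∘ (pb1 (composable sp X) ∘ pb1 (composable3 sp X)) =
  rg_c X ∘ (mg_m X ∘ pb2 (composable3 sp X)).
Proof.
by rewrite [RHS]compA mg_cm -compA -pb_comm !compA pb_comm.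
Qed.

Lemma m_times_one_comm (CC : Category) (sp : has_split_pullbacks CC)
  (X : MultGraph sp) :
  rg_d X ∘ (mg_m X ∘ pb1 (composable3 sp X)) =
  rg_c X ∘ (pb2 (composable sp X) ∘ pb2 (composable3 sp X)).
Proof.
by rewrite [LHS]compA mg_dm -compA pb_comm !compA pb_comm.
Qed.

Definition one_times_m (CC : Category) (sp : has_split_pullbacks CC)
  (X : MultGraph sp) : Hom (composable3 sp X) (composable sp X) :=
  pb_pair (composable sp X)
    (pb1 (composable sp X) ∘ pb1 (composable3 sp X))
    (mg_m X ∘ pb2 (composable3 sp X))
    (one_times_m_comm X).

Definition m_times_one (CC : Category) (sp : has_split_pullbacks CC)
  (X : MultGraph sp) : Hom (composable3 sp X) (composable sp X) :=
  pb_pair (composable sp X)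
    (mg_m X ∘ pb1 (composable3 sp X))
    (pb2 (composable sp X) ∘ pb2 (composable3 sp X))
    (m_times_one_comm X).

Definition is_internal_category (CC : Category) (sp : has_split_pullbacks CC)
  (X : MG sp) : Prop :=
  mg_m X ∘ one_times_m X = mg_m X ∘ m_times_one X.

Definition Cat (CC : Category) (sp : has_split_pullbacks CC) : Category :=
  FullSub (@is_internal_category CC sp).

Definition U2 (CC : Category) (sp : has_split_pullbacks CC) :
  Functor (Cat sp) (MG sp) :=
  full_inclusion (@is_internal_category CC sp).

Lemma pair_one_t_comm (CC : Category) (G : ReflGraph CC)
  (t : Hom (rg1 G) (rg1 G)) :
  rg_c G ∘ t = rg_d G -> rg_d G ∘ idm (rg1 G) = rg_c G ∘ t.
Proof. by move=> ->; rewrite compm1. Qed.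

Lemma pair_t_one_comm (CC : Category) (G : ReflGraph CC)
  (t : Hom (rg1 G) (rg1 G)) :
  rg_d G ∘ t = rg_c G -> rg_d G ∘ t = rg_c G ∘ idm (rg1 G).
Proof. by move=> ->; rewrite compm1. Qed.

Definition is_internal_groupoid (CC : Category) (sp : has_split_pullbacks CC)
  (Y : Cat sp) : Prop :=
  let X : MultGraph sp := proj1_sig Y in
  exists (t : Hom (rg1 X) (rg1 X))
         (ct : rg_c X ∘ t = rg_d X) (dt : rg_d X ∘ t = rg_c X),
    mg_m X ∘ pb_pair (composable sp X) (idm (rg1 X)) t (pair_one_t_comm ct)
      = rg_e X ∘ rg_c X /\
    mg_m X ∘ pb_pair (composable sp X) t (idm (rg1 X)) (pair_t_one_comm dt)
      = rg_e X ∘ rg_d X.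

Definition Grpd (CC : Category) (sp : has_split_pullbacks CC) : Category :=
  FullSub (@is_internal_groupoid CC sp).

Definition U3 (CC : Category) (sp : has_split_pullbacks CC) :
  Functor (Grpd sp) (Cat sp) :=
  full_inclusion (@is_internal_groupoid CC sp).

Definition U12 (CC : Category) (sp : has_split_pullbacks CC) :
  Functor (Cat sp) (RG CC) :=
  functor_comp (U1 sp) (U2 sp).

Definition U123 (CC : Category) (sp : has_split_pullbacks CC) :
  Functor (Grpd sp) (RG CC) :=
  functor_comp (U12 sp) (U3 sp).

Record SpanOb (CC : Category) : Type := MkSpan {
  spD : CC;
  spD0 : CC;
  spD0' : CC;
  sp_d : Hom spD spD0;
  sp_c : Hom spD spD0' }.

Record SpanHom (CC : Category) (S T : SpanOb CC) : Type := MkSpanHom {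
  sph : Hom (spD S) (spD T);
  sph0 : Hom (spD0 S) (spD0 T);
  sph0' : Hom (spD0' S) (spD0' T);
  sph_d : sp_d T ∘ sph = sph0 ∘ sp_d S;
  sph_c : sp_c T ∘ sph = sph0' ∘ sp_c S }.

Lemma SpanHom_eq (CC : Category) (S T : SpanOb CC) (f g : SpanHom S T) :
  sph f = sph g -> sph0 f = sph0 g -> sph0' f = sph0' g -> f = g.
Proof.
case: f g => [f f0 f0' a b] [g g0 g0' a' b'] /= e e0 e0'; subst g g0 g0'.
by f_equal; apply: proof_irrelevance.
Qed.

Definition SpanHom_id (CC : Category) (S : SpanOb CC) : SpanHom S S.
Proof. by exists (idm _) (idm _) (idm _); rewrite comp1m compm1. Defined.

Definition SpanHom_comp (CC : Category) (S T W : SpanOb CC)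
  (g : SpanHom T W) (f : SpanHom S T) : SpanHom S W.
Proof.
exists (sph g ∘ sph f) (sph0 g ∘ sph0 f) (sph0' g ∘ sph0' f).
- by rewrite compA sph_d -compA sph_d compA.
- by rewrite compA sph_c -compA sph_c compA.
Defined.

Definition Span (CC : Category) : Category.
Proof.
refine (@MkCategory (SpanOb CC) (@SpanHom CC) (@SpanHom_id CC)
  (@SpanHom_comp CC) _ _ _).
- by move=> *; apply: SpanHom_eq; rewrite /= compA.
- by move=> *; apply: SpanHom_eq; rewrite /= comp1m.
- by move=> *; apply: SpanHom_eq; rewrite /= compm1.
Defined.

Lemma kernel_pair_pb1_split (CC : Category) (A B : CC) (f : Hom A B)
  (P : Pullback f f) : split_epi (pb1 P).
Proof. exists (pb_pair P (idm A) (idm A) eq_refl); exact: pb1_pair. Qed.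

Lemma kernel_pair_pb2_split (CC : Category) (A B : CC) (f : Hom A B)
  (P : Pullback f f) : split_epi (pb2 P).
Proof. exists (pb_pair P (idm A) (idm A) eq_refl); exact: pb2_pair. Qed.

Definition kerd (CC : Category) (kp : has_kernel_pairs CC) (S : SpanOb CC) :
  Pullback (sp_d S) (sp_d S) := kp _ _ (sp_d S).

Definition kerc (CC : Category) (kp : has_kernel_pairs CC) (S : SpanOb CC) :
  Pullback (sp_c S) (sp_c S) := kp _ _ (sp_c S).

(** Triples [(x, y, z)] with [d x = d y] and [c y = c z], as pairs
    [((x, y), (y, z))]. *)
Definition triples (CC : Category) (kp : has_kernel_pairs CC)
  (sp : has_split_pullbacks CC) (S : SpanOb CC) :
  Pullback (pb2 (kerd kp S)) (pb1 (kerc kp S)) :=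
  sp _ _ _ _ _ (kernel_pair_pb2_split (kerd kp S))
    (kernel_pair_pb1_split (kerc kp S)).

Lemma pre_i1_comm (CC : Category) (kp : has_kernel_pairs CC) (S : SpanOb CC) :
  pb2 (kerd kp S) ∘ idm (kerd kp S) =
  pb1 (kerc kp S) ∘ pb_pair (kerc kp S) (pb2 (kerd kp S)) (pb2 (kerd kp S)) eq_refl.
Proof. by rewrite pb1_pair compm1. Qed.

Lemma pre_i2_comm (CC : Category) (kp : has_kernel_pairs CC) (S : SpanOb CC) :
  pb2 (kerd kp S) ∘ pb_pair (kerd kp S) (pb1 (kerc kp S)) (pb1 (kerc kp S)) eq_refl =
  pb1 (kerc kp S) ∘ idm (kerc kp S).
Proof. by rewrite pb2_pair compm1. Qed.

Definition pre_i1 (CC : Category) (kp : has_kernel_pairs CC)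
  (sp : has_split_pullbacks CC) (S : SpanOb CC) :
  Hom (kerd kp S) (triples kp sp S) :=
  pb_pair (triples kp sp S) (idm (kerd kp S))
    (pb_pair (kerc kp S) (pb2 (kerd kp S)) (pb2 (kerd kp S)) eq_refl)
    (pre_i1_comm kp S).

Definition pre_i2 (CC : Category) (kp : has_kernel_pairs CC)
  (sp : has_split_pullbacks CC) (S : SpanOb CC) :
  Hom (kerc kp S) (triples kp sp S) :=
  pb_pair (triples kp sp S)
    (pb_pair (kerd kp S) (pb1 (kerc kp S)) (pb1 (kerc kp S)) eq_refl)
    (idm (kerc kp S))
    (pre_i2_comm kp S).

Record Pregroupoid (CC : Category) (kp : has_kernel_pairs CC)
  (sp : has_split_pullbacks CC) : Type := MkPregroupoid {
  pg_span :> SpanOb CC;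
  pg_p : Hom (triples kp sp pg_span) (spD pg_span);
  pg_i1 : pg_p ∘ pre_i1 kp sp pg_span = pb1 (kerd kp pg_span);
  pg_i2 : pg_p ∘ pre_i2 kp sp pg_span = pb2 (kerc kp pg_span);
  pg_d : sp_d pg_span ∘ pg_p =
    sp_d pg_span ∘ (pb2 (kerc kp pg_span) ∘ pb2 (triples kp sp pg_span));
  pg_c : sp_c pg_span ∘ pg_p =
    sp_c pg_span ∘ (pb1 (kerd kp pg_span) ∘ pb1 (triples kp sp pg_span)) }.

Definition kerd_map (CC : Category) (kp : has_kernel_pairs CC)
  (S T : SpanOb CC) (f : SpanHom S T) : Hom (kerd kp S) (kerd kp T) :=
  pb_map (kerd kp S) (kerd kp T) (sph f) (sph f) (sph0 f) (sph_d f) (sph_d f).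

Definition kerc_map (CC : Category) (kp : has_kernel_pairs CC)
  (S T : SpanOb CC) (f : SpanHom S T) : Hom (kerc kp S) (kerc kp T) :=
  pb_map (kerc kp S) (kerc kp T) (sph f) (sph f) (sph0' f) (sph_c f) (sph_c f).

Lemma kerd_map_pb2 (CC : Category) (kp : has_kernel_pairs CC)
  (S T : SpanOb CC) (f : SpanHom S T) :
  pb2 (kerd kp T) ∘ kerd_map kp f = sph f ∘ pb2 (kerd kp S).
Proof. exact: pb2_pair. Qed.

Lemma kerc_map_pb1 (CC : Category) (kp : has_kernel_pairs CC)
  (S T : SpanOb CC) (f : SpanHom S T) :
  pb1 (kerc kp T) ∘ kerc_map kp f = sph f ∘ pb1 (kerc kp S).
Proof. exact: pb1_pair. Qed.

Definition triples_map (CC : Category) (kp : has_kernel_pairs CC)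
  (sp : has_split_pullbacks CC) (S T : SpanOb CC) (f : SpanHom S T) :
  Hom (triples kp sp S) (triples kp sp T) :=
  pb_map (triples kp sp S) (triples kp sp T) (kerd_map kp f) (kerc_map kp f)
    (sph f) (kerd_map_pb2 kp f) (kerc_map_pb1 kp f).

Definition preserves_p (CC : Category) (kp : has_kernel_pairs CC)
  (sp : has_split_pullbacks CC) (X Y : Pregroupoid kp sp) (f : SpanHom X Y) :
  Prop :=
  sph f ∘ pg_p X = pg_p Y ∘ triples_map kp sp f.

Lemma preserves_p_id (CC : Category) (kp : has_kernel_pairs CC)
  (sp : has_split_pullbacks CC) (X : Pregroupoid kp sp) :
  preserves_p (idm (pg_span X : Span CC)).
Proof.
rewrite /preserves_p /triples_map pb_map_id ?comp1m ?compm1 //;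
  exact: pb_map_id.
Qed.

Lemma preserves_p_comp (CC : Category) (kp : has_kernel_pairs CC)
  (sp : has_split_pullbacks CC) (X Y Z : Pregroupoid kp sp)
  (g : @Hom (Span CC) Y Z) (f : @Hom (Span CC) X Y) :
  preserves_p g -> preserves_p f -> preserves_p (g ∘ f).
Proof.
rewrite /preserves_p => hg hf.
have -> : triples_map kp sp (g ∘ f) = triples_map kp sp g ∘ triples_map kp sp f.
  by apply: pb_map_comp; apply: pb_map_comp.
by rewrite compA -hg /= -!compA hf.
Qed.

Definition PreGrpd (CC : Category) (kp : has_kernel_pairs CC)
  (sp : has_split_pullbacks CC) : Category :=
  @OverCat (Span CC) (Pregroupoid kp sp) (@pg_span CC kp sp)
    (@preserves_p CC kp sp) (@preserves_p_id CC kp sp)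
    (@preserves_p_comp CC kp sp).

Definition V (CC : Category) (kp : has_kernel_pairs CC)
  (sp : has_split_pullbacks CC) : Functor (PreGrpd kp sp) (Span CC) :=
  @over_forget (Span CC) (Pregroupoid kp sp) (@pg_span CC kp sp)
    (@preserves_p CC kp sp) (@preserves_p_id CC kp sp)
    (@preserves_p_comp CC kp sp).

Lemma triple_comm (CC : Category) (kp : has_kernel_pairs CC) (S : SpanOb CC)
  (T : CC) (x y z : Hom T (spD S))
  (hd : sp_d S ∘ x = sp_d S ∘ y) (hc : sp_c S ∘ y = sp_c S ∘ z) :
  pb2 (kerd kp S) ∘ pb_pair (kerd kp S) x y hd =
  pb1 (kerc kp S) ∘ pb_pair (kerc kp S) y z hc.
Proof. by rewrite pb1_pair pb2_pair. Qed.

(** [p(x, y, z)] for generalised elements [x], [y], [z]. *)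
Definition app_p (CC : Category) (kp : has_kernel_pairs CC)
  (sp : has_split_pullbacks CC) (X : Pregroupoid kp sp) (T : CC)
  (x y z : Hom T (spD X))
  (hd : sp_d X ∘ x = sp_d X ∘ y) (hc : sp_c X ∘ y = sp_c X ∘ z) :
  Hom T (spD X) :=
  pg_p X ∘ pb_pair (triples kp sp X)
             (pb_pair (kerd kp X) x y hd) (pb_pair (kerc kp X) y z hc)
             (triple_comm kp hd hc).

Arguments app_p {CC kp sp} X {T} x y z hd hc.

(** The hypotheses say precisely that both sides make sense. *)
Definition associative (CC : Category) (kp : has_kernel_pairs CC)
  (sp : has_split_pullbacks CC) (X : Pregroupoid kp sp) : Prop :=
  forall (T : CC) (x y z u v : Hom T (spD X))
    (dxy : sp_d X ∘ x = sp_d X ∘ y) (cyz : sp_c X ∘ y = sp_c X ∘ z)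
    (dzu : sp_d X ∘ z = sp_d X ∘ u) (cuv : sp_c X ∘ u = sp_c X ∘ v)
    (dpu : sp_d X ∘ app_p X x y z dxy cyz = sp_d X ∘ u)
    (cyp : sp_c X ∘ y = sp_c X ∘ app_p X z u v dzu cuv),
    app_p X (app_p X x y z dxy cyz) u v dpu cuv =
    app_p X x y (app_p X z u v dzu cuv) dxy cyp.

(* Main.v *)
(** A multiplication on the reflexive graph of triples [(x, y, z)] with
    [c x = c y] and [d y = d z], with codomain [x] and domain [z], turns
    [(x, x, y) (y, z, z)] into a triple [(x, p(x, y, z), z)], and so yields a
    natural pregroupoid structure.  Given one, the morphism of (v) is
    [phi(a, c) = p(alpha a, beta b, gamma c)]; it is unique because
    [(a, c) = p((a, s b), (r b, s b), (r b, c))] for the span of the two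
    projections of the pullback and [phi] is a morphism of spans.

    Conversely (v) says that a morphism out of a pullback of split epimorphisms is
    determined by its restrictions along [e_1] and [e_2] and by its composites
    with [d] and [c].  Hence multiplications and pregroupoid structures exist, are
    unique, are preserved by every morphism, and are associative; inverses are read
    off the pregroupoid structures. *)

From Stdlib Require Import ssreflect ProofIrrelevance FunctionalExtensionality
  ClassicalEpsilon.
Require Import Defs.

Set Implicit Arguments.
Unset Strict Implicit.
Unset Printing Implicit Defensive.

Local Open Scope cat_scope.

(** * Strict isomorphisms of categories *)

(** Strict equality of functors identifies objects only propositionally, so morphisms are
    transported along these equations before being compared. *)
Definition cast_hom (C : Category) (A B A' B' : C) (eA : A = A') (eB : B = B')
  (f : Hom A B) : Hom A' B' :=
  match eA in _ = X, eB in _ = Y return Hom X Y with eq_refl, eq_refl => f end.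

Lemma cast_hom_id (C : Category) (A B : C) (eA : A = A) (eB : B = B)
  (f : Hom A B) : cast_hom eA eB f = f.
Proof.
by rewrite (proof_irrelevance _ eA eq_refl) (proof_irrelevance _ eB eq_refl).
Qed.

Lemma cast_hom_trans (C : Category) (A B A' B' A'' B'' : C) (eA : A = A')
  (eB : B = B') (eA' : A' = A'') (eB' : B' = B'') (f : Hom A B) :
  cast_hom eA' eB' (cast_hom eA eB f) =
  cast_hom (eq_trans eA eA') (eq_trans eB eB') f.
Proof. by destruct eA', eB', eA, eB. Qed.

Lemma cast_hom_idm (C : Category) (A A' : C) (e : A = A') :
  cast_hom e e (idm A) = idm A'.
Proof. by destruct e. Qed.

Lemma cast_hom_comp (C : Category) (A B E A' B' E' : C) (eA : A = A')
  (eB : B = B') (eE : E = E') (g : Hom B E) (f : Hom A B) :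
  cast_hom eA eE (g ∘ f) = cast_hom eB eE g ∘ cast_hom eA eB f.
Proof. by destruct eA, eB, eE. Qed.

Lemma fmap_cast_hom (C D : Category) (F : Functor C D) (A B A' B' : C)
  (eA : A = A') (eB : B = B') (f : Hom A B) :
  fmap F (cast_hom eA eB f) = cast_hom (f_equal F eA) (f_equal F eB) (fmap F f).
Proof. by destruct eA, eB. Qed.

(** Once the object maps are identified by extensionality, every cast runs along some [X = X] and is
    trivial; the functor laws agree by proof irrelevance. *)
Lemma functor_eq (C D : Category) (F G : Functor C D) (e : forall A, F A = G A) :
  (forall A B (f : Hom A B), cast_hom (e A) (e B) (fmap F f) = fmap G f) -> F = G.
Proof.
case: F G e => [F mF F1 FM] [G mG G1 GM] /= e eFG.
have eo : F = G by apply: functional_extensionality.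
subst G.
have em : mF = mG.
  do 3 (apply: functional_extensionality_dep => ?).
  by rewrite -eFG cast_hom_id.
by subst mG; f_equal; apply: proof_irrelevance.
Qed.

Definition bijective_on_objects (C D : Category) (U : Functor C D) : Prop :=
  forall Y : D, exists! X : C, U X = Y.

Definition fully_faithful (C D : Category) (U : Functor C D) : Prop :=
  forall (A B : C) (g : Hom (U A) (U B)), exists! f : Hom A B, fmap U f = g.

(** Choice turns unique preimages into an inverse on objects; morphisms are transported to these
    objects and lifted by fullness. Faithfulness makes the result functorial. *)
Lemma bijective_isomorphism (C D : Category) (U : Functor C D) :
  bijective_on_objects U -> fully_faithful U -> is_isomorphism U.
Proof.
move=> bo ff.
pose sobj Y := constructive_indefinite_description _ (bo Y).
pose s Y := proj1_sig (sobj Y).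
have hs Y : U (s Y) = Y by case: (proj2_sig (sobj Y)).
have su X : s (U X) = X by case: (proj2_sig (sobj (U X))) => _; apply.
pose shom A B (f : Hom A B) := constructive_indefinite_description _
  (ff _ _ (cast_hom (eq_sym (hs A)) (eq_sym (hs B)) f)).
pose ms A B (f : Hom A B) := proj1_sig (shom A B f).
have hms A B (f : Hom A B) :
    fmap U (ms A B f) = cast_hom (eq_sym (hs A)) (eq_sym (hs B)) f.
  by case: (proj2_sig (shom A B f)).
have inj A B (f g : Hom A B) : fmap U f = fmap U g -> f = g.
  by move=> e; case: (ff _ _ (fmap U g)) => h [_ u]; rewrite -(u f e) (u g).
have s1 A : ms A A (idm A) = idm (s A).
  by apply: inj; rewrite hms cast_hom_idm fmap1.
have sM (A B E : D) (g : Hom B E) (f : Hom A B) :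
    ms A E (g ∘ f) = ms B E g ∘ ms A B f.
  by apply: inj; rewrite fmapM !hms -cast_hom_comp.
pose S := @MkFunctor D C s ms s1 sM.
exists S; split.
- apply: (@functor_eq _ _ (functor_comp U S) (functor_id D) hs) => A B f /=.
  by rewrite hms cast_hom_trans cast_hom_id.
- apply: (@functor_eq _ _ (functor_comp S U) (functor_id C) su) => A B f /=.
  by apply: inj; rewrite fmap_cast_hom hms cast_hom_trans cast_hom_id.
Qed.

Lemma bijective_on_objects_comp (C D E : Category) (G : Functor D E)
  (F : Functor C D) :
  bijective_on_objects G -> bijective_on_objects F ->
  bijective_on_objects (functor_comp G F).
Proof.
move=> hG hF Z; case: (hG Z) => Y [eY uY]; case: (hF Y) => X [eX uX].
exists X; split=> [|X' eX'] /=; first by rewrite eX.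
by apply: uX; rewrite (uY (F X')).
Qed.

Lemma fully_faithful_comp (C D E : Category) (G : Functor D E)
  (F : Functor C D) :
  fully_faithful G -> fully_faithful F -> fully_faithful (functor_comp G F).
Proof.
move=> hG hF A B k; case: (hG _ _ k) => h [eh uh]; case: (hF _ _ h) => f [ef uf].
exists f; split=> [|f' ef'] /=; first by rewrite ef.
by apply: uf; rewrite (uh (fmap F f')).
Qed.

Lemma full_inclusion_bijective (B : Category) (P : B -> Prop) :
  (forall x, P x) -> bijective_on_objects (full_inclusion P).
Proof.
move=> hP x; exists (exist _ x (hP x)); split=> // y e.
exact: sig_eq.
Qed.

Lemma full_inclusion_fully_faithful (B : Category) (P : B -> Prop) :
  fully_faithful (full_inclusion P).
Proof. by move=> x y g; exists g; split. Qed.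

Lemma over_forget_fully_faithful (B : Category) (X : Type) (u : X -> B)
  (P : forall x y : X, Hom (u x) (u y) -> Prop)
  (P1 : forall x, P x x (idm (u x)))
  (PM : forall x y z (g : Hom (u y) (u z)) (f : Hom (u x) (u y)),
    P y z g -> P x y f -> P x z (g ∘ f)) :
  (forall x y f, P x y f) -> fully_faithful (@over_forget B X u P P1 PM).
Proof.
move=> hP x y g; exists (exist _ g (hP x y g)); split=> // h e.
exact: sig_eq.
Qed.

(** If [S] is a section of the composite, [F S] is one of [G]: the two bracketings share their
    object and morphism maps. *)
Lemma has_section_comp (C D E : Category) (G : Functor D E) (F : Functor C D) :
  has_section (functor_comp G F) -> has_section G.
Proof.
case=> S e; exists (functor_comp F S); rewrite -e.
by apply: (@functor_eq _ _ (functor_comp G (functor_comp F S))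
  (functor_comp (functor_comp G F) S) (fun A => eq_refl)).
Qed.

(** For [F] a forgetful functor after its section, the structure found for [b] lives on [F b], equal
    to [b] only propositionally. With [F] a variable the equation can be substituted, which avoids
    casts. *)
Lemma section_structure (B : Category) (Q : B -> Type)
  (N : forall a b, Q a -> Q b -> Hom a b -> Prop) (F : Functor B B)
  (q : forall b, Q (F b)) :
  F = functor_id B -> (forall a b (f : Hom a b), N _ _ (q a) (q b) (fmap F f)) ->
  exists q' : forall b, Q b, forall a b (f : Hom a b), N _ _ (q' a) (q' b) f.
Proof. by move=> e; subst F; exists q. Qed.

(** * Calculus of pullbacks and generalised elements *)

Section Pullbacks.

Context (CC : Category) (A B C : CC) (f : Hom A C) (g : Hom B C)
  (P : Pullback f g).

Lemma pb1_pairA (T T' : CC) (x : Hom T A) (y : Hom T B) (h : f ∘ x = g ∘ y)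
  (w : Hom T' T) : pb1 P ∘ (pb_pair P x y h ∘ w) = x ∘ w.
Proof. by rewrite compA pb1_pair. Qed.

Lemma pb2_pairA (T T' : CC) (x : Hom T A) (y : Hom T B) (h : f ∘ x = g ∘ y)
  (w : Hom T' T) : pb2 P ∘ (pb_pair P x y h ∘ w) = y ∘ w.
Proof. by rewrite compA pb2_pair. Qed.

Lemma pb_pair_eq (T : CC) (x x' : Hom T A) (y y' : Hom T B)
  (h : f ∘ x = g ∘ y) (h' : f ∘ x' = g ∘ y') :
  x = x' -> y = y' -> pb_pair P x y h = pb_pair P x' y' h'.
Proof. by move=> ex ey; apply: pb_ext; rewrite ?pb1_pair ?pb2_pair. Qed.

End Pullbacks.

Lemma comp_assoc (CC : Category) (A B C D : CC) (h : Hom C D) (g : Hom B C)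
  (f : Hom A B) : h ∘ g ∘ f = h ∘ (g ∘ f).
Proof. by rewrite compA. Qed.

(** Reassociates to the right and evaluates projections of pairings, also when a further morphism
    follows. *)
Definition pbE :=
  (comp_assoc, pb1_pair, pb2_pair, pb1_pairA, pb2_pairA, @comp1m, @compm1).

Section TripleProjections.

Context (CC : Category) (kp : has_kernel_pairs CC) (sp : has_split_pullbacks CC).

Section Triples.

Context (S : SpanOb CC).

Definition triple1 : Hom (triples kp sp S) (spD S) :=
  pb1 (kerd kp S) ∘ pb1 (triples kp sp S).
Definition triple2 : Hom (triples kp sp S) (spD S) :=
  pb2 (kerd kp S) ∘ pb1 (triples kp sp S).
Definition triple3 : Hom (triples kp sp S) (spD S) :=
  pb2 (kerc kp S) ∘ pb2 (triples kp sp S).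

Lemma triple2E : triple2 = pb1 (kerc kp S) ∘ pb2 (triples kp sp S).
Proof. exact: pb_comm. Qed.

Lemma triple_d : sp_d S ∘ triple1 = sp_d S ∘ triple2.
Proof. by rewrite /triple1 /triple2 !compA pb_comm. Qed.

Lemma triple_c : sp_c S ∘ triple2 = sp_c S ∘ triple3.
Proof. by rewrite triple2E /triple3 !compA pb_comm. Qed.

Lemma triples_ext (T : CC) (w w' : Hom T (triples kp sp S)) :
  triple1 ∘ w = triple1 ∘ w' -> triple2 ∘ w = triple2 ∘ w' ->
  triple3 ∘ w = triple3 ∘ w' -> w = w'.
Proof.
(* The middle components are compared twice, through the kernel pair of [d] and through that of
   [c]. *)
rewrite /triple1 /triple3 => e1 e2 e3; move: (e2) (e2).
rewrite {1 2}/triple2 triple2E => e2' e2''.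
by apply: pb_ext; apply: pb_ext; rewrite !compA.
Qed.

Lemma triple1_pre_i1 : triple1 ∘ pre_i1 kp sp S = pb1 (kerd kp S).
Proof. by rewrite /triple1 /pre_i1 ?pbE. Qed.

Lemma triple2_pre_i1 : triple2 ∘ pre_i1 kp sp S = pb2 (kerd kp S).
Proof. by rewrite /triple2 /pre_i1 ?pbE. Qed.

Lemma triple3_pre_i1 : triple3 ∘ pre_i1 kp sp S = pb2 (kerd kp S).
Proof. by rewrite /triple3 /pre_i1 ?pbE. Qed.

Lemma triple1_pre_i2 : triple1 ∘ pre_i2 kp sp S = pb1 (kerc kp S).
Proof. by rewrite /triple1 /pre_i2 ?pbE. Qed.

Lemma triple2_pre_i2 : triple2 ∘ pre_i2 kp sp S = pb1 (kerc kp S).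
Proof. by rewrite /triple2 /pre_i2 ?pbE. Qed.

Lemma triple3_pre_i2 : triple3 ∘ pre_i2 kp sp S = pb2 (kerc kp S).
Proof. by rewrite /triple3 /pre_i2 ?pbE. Qed.

Definition triple (T : CC) (x y z : Hom T (spD S))
  (hd : sp_d S ∘ x = sp_d S ∘ y) (hc : sp_c S ∘ y = sp_c S ∘ z) :
  Hom T (triples kp sp S) :=
  pb_pair (triples kp sp S) (pb_pair (kerd kp S) x y hd)
    (pb_pair (kerc kp S) y z hc) (triple_comm kp hd hc).

Context (T : CC) (x y z : Hom T (spD S))
  (hd : sp_d S ∘ x = sp_d S ∘ y) (hc : sp_c S ∘ y = sp_c S ∘ z).

Lemma triple1_triple : triple1 ∘ triple hd hc = x.
Proof. by rewrite /triple1 /triple ?pbE. Qed.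

Lemma triple2_triple : triple2 ∘ triple hd hc = y.
Proof. by rewrite /triple2 /triple ?pbE. Qed.

Lemma triple3_triple : triple3 ∘ triple hd hc = z.
Proof. by rewrite /triple3 /triple ?pbE. Qed.

Lemma triple1_tripleA (W : CC) (w : Hom W T) :
  triple1 ∘ (triple hd hc ∘ w) = x ∘ w.
Proof. by rewrite compA triple1_triple. Qed.

Lemma triple2_tripleA (W : CC) (w : Hom W T) :
  triple2 ∘ (triple hd hc ∘ w) = y ∘ w.
Proof. by rewrite compA triple2_triple. Qed.

Lemma triple3_tripleA (W : CC) (w : Hom W T) :
  triple3 ∘ (triple hd hc ∘ w) = z ∘ w.
Proof. by rewrite compA triple3_triple. Qed.

End Triples.

Section TriplesMap.

Context (S T : SpanOb CC) (f : SpanHom S T).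

Lemma triple1_map :
  triple1 T ∘ triples_map kp sp f = sph f ∘ triple1 S.
Proof. by rewrite /triple1 /triples_map /kerd_map /pb_map ?pbE. Qed.

Lemma triple2_map :
  triple2 T ∘ triples_map kp sp f = sph f ∘ triple2 S.
Proof. by rewrite /triple2 /triples_map /kerd_map /pb_map ?pbE. Qed.

Lemma triple3_map :
  triple3 T ∘ triples_map kp sp f = sph f ∘ triple3 S.
Proof. by rewrite /triple3 /triples_map /kerc_map /pb_map ?pbE. Qed.

Lemma triple1_mapA (W : CC) (w : Hom W (triples kp sp S)) :
  triple1 T ∘ (triples_map kp sp f ∘ w) = sph f ∘ (triple1 S ∘ w).
Proof. by rewrite compA triple1_map compA. Qed.

Lemma triple2_mapA (W : CC) (w : Hom W (triples kp sp S)) :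
  triple2 T ∘ (triples_map kp sp f ∘ w) = sph f ∘ (triple2 S ∘ w).
Proof. by rewrite compA triple2_map compA. Qed.

Lemma triple3_mapA (W : CC) (w : Hom W (triples kp sp S)) :
  triple3 T ∘ (triples_map kp sp f ∘ w) = sph f ∘ (triple3 S ∘ w).
Proof. by rewrite compA triple3_map compA. Qed.

End TriplesMap.

End TripleProjections.

Definition tripleE :=
  (triple1_pre_i1, triple2_pre_i1, triple3_pre_i1, triple1_pre_i2,
   triple2_pre_i2, triple3_pre_i2, triple1_triple, triple2_triple, triple3_triple,
   triple1_tripleA, triple2_tripleA, triple3_tripleA,
   triple1_map, triple2_map, triple3_map,
   triple1_mapA, triple2_mapA, triple3_mapA, pbE).

Lemma triple_comp_eq (CC : Category) (kp : has_kernel_pairs CC)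
  (sp : has_split_pullbacks CC) (S : SpanOb CC) (T T' W : CC)
  (x y z : Hom T (spD S)) (x' y' z' : Hom T' (spD S)) hd hc hd' hc'
  (w : Hom W T) (w' : Hom W T') :
  x ∘ w = x' ∘ w' -> y ∘ w = y' ∘ w' -> z ∘ w = z' ∘ w' ->
  @triple _ kp sp S T x y z hd hc ∘ w = @triple _ kp sp S T' x' y' z' hd' hc' ∘ w'.
Proof. by move=> ? ? ?; apply: triples_ext; rewrite ?tripleE. Qed.

Lemma triples_map_triple (CC : Category) (kp : has_kernel_pairs CC)
  (sp : has_split_pullbacks CC) (S S' : SpanOb CC) (f : SpanHom S S')
  (T T' : CC) (x y z : Hom T (spD S)) (x' y' z' : Hom T' (spD S')) hd hc hd' hc'
  (w' : Hom T T') :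
  sph f ∘ x = x' ∘ w' -> sph f ∘ y = y' ∘ w' -> sph f ∘ z = z' ∘ w' ->
  triples_map kp sp f ∘ @triple _ kp sp S T x y z hd hc =
  @triple _ kp sp S' T' x' y' z' hd' hc' ∘ w'.
Proof. by move=> ? ? ?; apply: triples_ext; rewrite ?tripleE. Qed.

(** * The pregroupoid operation on generalised elements *)

Section Laws.

Context (CC : Category) (kp : has_kernel_pairs CC) (sp : has_split_pullbacks CC).
Context (X : Pregroupoid kp sp).

(** The three components are jointly monic, so any [w] with these components computes p(x, y, z). *)
Lemma app_pE (T : CC) (w : Hom T (triples kp sp X)) (x y z : Hom T (spD X))
  (hd : sp_d X ∘ x = sp_d X ∘ y) (hc : sp_c X ∘ y = sp_c X ∘ z) :
  triple1 kp sp X ∘ w = x -> triple2 kp sp X ∘ w = y ->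
  triple3 kp sp X ∘ w = z ->
  app_p X x y z hd hc = pg_p X ∘ w.
Proof.
move=> e1 e2 e3; rewrite /app_p; congr (_ ∘ _); symmetry.
by apply: triples_ext; rewrite ?triple1_triple ?triple2_triple ?triple3_triple.
Qed.

Lemma app_p_eq (T : CC) (x y z x' y' z' : Hom T (spD X)) hd hc hd' hc' :
  x = x' -> y = y' -> z = z' -> app_p X x y z hd hc = app_p X x' y' z' hd' hc'.
Proof.
by move=> ? ? ?; apply: app_pE;
  rewrite ?triple1_triple ?triple2_triple ?triple3_triple.
Qed.

Lemma app_p_comp (T T' : CC) (w : Hom T' T) (x y z : Hom T (spD X)) hd hc
  (x' y' z' : Hom T' (spD X)) hd' hc' :
  x ∘ w = x' -> y ∘ w = y' -> z ∘ w = z' ->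
  app_p X x y z hd hc ∘ w = app_p X x' y' z' hd' hc'.
Proof.
move=> ? ? ?; symmetry; rewrite {2}/app_p -compA.
by apply: app_pE; rewrite -/(triple kp sp hd hc) ?tripleE.
Qed.

(** Such a triple factors through [pre_i1]. The equation is a hypothesis rather than a repeated
    variable because [hd] and [hc] depend on the elements. *)
Lemma app_p_xyy (T : CC) (x y z : Hom T (spD X)) hd hc : y = z ->
  app_p X x y z hd hc = x.
Proof.
move=> eyz; rewrite (@app_pE _ (pre_i1 kp sp X ∘ pb_pair (kerd kp X) x y hd)).
1-3: by rewrite compA ?tripleE.
by rewrite compA pg_i1 pb1_pair.
Qed.

Lemma app_p_xxy (T : CC) (x y z : Hom T (spD X)) hd hc : x = y ->
  app_p X x y z hd hc = z.
Proof.
move=> exy; rewrite (@app_pE _ (pre_i2 kp sp X ∘ pb_pair (kerc kp X) y z hc)).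
1-3: by rewrite compA ?tripleE.
by rewrite compA pg_i2 pb2_pair.
Qed.

Lemma app_p_comp_xyy (T T' : CC) (w : Hom T' T) (x y z : Hom T (spD X)) hd hc :
  y ∘ w = z ∘ w -> app_p X x y z hd hc ∘ w = x ∘ w.
Proof.
move=> eyz.
have hd' : sp_d X ∘ (x ∘ w) = sp_d X ∘ (y ∘ w) by rewrite !compA hd.
have hc' : sp_c X ∘ (y ∘ w) = sp_c X ∘ (z ∘ w) by rewrite eyz.
by rewrite (@app_p_comp _ _ w _ _ _ _ _ _ _ _ hd' hc') // app_p_xyy.
Qed.

Lemma app_p_comp_xxy (T T' : CC) (w : Hom T' T) (x y z : Hom T (spD X)) hd hc :
  x ∘ w = y ∘ w -> app_p X x y z hd hc ∘ w = z ∘ w.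
Proof.
move=> exy.
have hd' : sp_d X ∘ (x ∘ w) = sp_d X ∘ (y ∘ w) by rewrite exy.
have hc' : sp_c X ∘ (y ∘ w) = sp_c X ∘ (z ∘ w) by rewrite !compA hc.
by rewrite (@app_p_comp _ _ w _ _ _ _ _ _ _ _ hd' hc') // app_p_xxy.
Qed.

Lemma app_p_d (T : CC) (x y z : Hom T (spD X)) hd hc :
  sp_d X ∘ app_p X x y z hd hc = sp_d X ∘ z.
Proof. by rewrite compA pg_d ?pbE. Qed.

Lemma app_p_c (T : CC) (x y z : Hom T (spD X)) hd hc :
  sp_c X ∘ app_p X x y z hd hc = sp_c X ∘ x.
Proof. by rewrite compA pg_c ?pbE. Qed.

End Laws.

Lemma app_p_preserved (CC : Category) (kp : has_kernel_pairs CC)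
  (sp : has_split_pullbacks CC) (X Y : Pregroupoid kp sp) (h : SpanHom X Y) (T : CC)
  (x y z : Hom T (spD X)) hd hc hd' hc' : preserves_p h ->
  sph h ∘ app_p X x y z hd hc =
  app_p Y (sph h ∘ x) (sph h ∘ y) (sph h ∘ z) hd' hc'.
Proof.
move=> hp; symmetry; rewrite {2}/app_p compA hp -compA
  -[pb_pair _ _ _ _]/(triple kp sp hd hc).
by apply: app_pE; rewrite ?tripleE.
Qed.

(** * From sections of [U1] to sections of [V] *)

(** Here the reflexive graph is a parameter, so that a section becomes a family of structures on the
    given graphs. *)
Record mult_structure (CC : Category) (sp : has_split_pullbacks CC)
  (G : ReflGraph CC) : Type := MultStructure {
  ms_m : Hom (composable sp G) (rg1 G);
  ms_e1 : ms_m ∘ pb_in1 (composable sp G) (rg_ce G) = idm (rg1 G);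
  ms_e2 : ms_m ∘ pb_in2 (composable sp G) (rg_de G) = idm (rg1 G);
  ms_dm : rg_d G ∘ ms_m = rg_d G ∘ pb2 (composable sp G);
  ms_cm : rg_c G ∘ ms_m = rg_c G ∘ pb1 (composable sp G) }.

Definition ms_graph (CC : Category) (sp : has_split_pullbacks CC)
  (G : ReflGraph CC) (m : mult_structure sp G) : MultGraph sp :=
  MkMultGraph (ms_e1 m) (ms_e2 m) (ms_dm m) (ms_cm m).

Lemma section_U1_structure (CC : Category) (sp : has_split_pullbacks CC) :
  has_section (U1 sp) ->
  exists m : forall G, mult_structure sp G, forall (G H : ReflGraph CC)
    (f : RGHom G H), preserves_mult (X := ms_graph (m G)) (Y := ms_graph (m H)) f.
Proof.
case=> S eS.
apply: (@section_structure (RG CC) (@mult_structure CC sp)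
  (fun G H m m' f => preserves_mult (X := ms_graph m) (Y := ms_graph m') f)
  (functor_comp (U1 sp) S)
  (fun G => MultStructure (mg_e1 (S G)) (mg_e2 (S G)) (mg_dm (S G)) (mg_cm (S G)))
  eS) => G H f.
exact: (proj2_sig (fmap S f)).
Qed.

Record pre_structure (CC : Category) (kp : has_kernel_pairs CC)
  (sp : has_split_pullbacks CC) (S : SpanOb CC) : Type := PreStructure {
  ps_p : Hom (triples kp sp S) (spD S);
  ps_i1 : ps_p ∘ pre_i1 kp sp S = pb1 (kerd kp S);
  ps_i2 : ps_p ∘ pre_i2 kp sp S = pb2 (kerc kp S);
  ps_d : sp_d S ∘ ps_p = sp_d S ∘ (pb2 (kerc kp S) ∘ pb2 (triples kp sp S));
  ps_c : sp_c S ∘ ps_p = sp_c S ∘ (pb1 (kerd kp S) ∘ pb1 (triples kp sp S)) }.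

Definition ps_pregroupoid (CC : Category) (kp : has_kernel_pairs CC)
  (sp : has_split_pullbacks CC) (S : SpanOb CC) (p : pre_structure kp sp S) :
  Pregroupoid kp sp :=
  MkPregroupoid (ps_i1 p) (ps_i2 p) (ps_d p) (ps_c p).

Lemma section_V_structure (CC : Category) (kp : has_kernel_pairs CC)
  (sp : has_split_pullbacks CC) :
  has_section (V kp sp) ->
  exists p : forall S, pre_structure kp sp S, forall (S T : SpanOb CC)
    (f : SpanHom S T),
    preserves_p (X := ps_pregroupoid (p S)) (Y := ps_pregroupoid (p T)) f.
Proof.
case=> F eF.
apply: (@section_structure (Span CC) (@pre_structure CC kp sp)
  (fun S T p q f =>
     preserves_p (X := ps_pregroupoid p) (Y := ps_pregroupoid q) f)
  (functor_comp (V kp sp) F)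
  (fun S => PreStructure (pg_i1 (F S)) (pg_i2 (F S)) (pg_d (F S)) (pg_c (F S)))
  eF) => S T f.
exact: (proj2_sig (fmap F f)).
Qed.

Lemma structure_section_V (CC : Category) (kp : has_kernel_pairs CC)
  (sp : has_split_pullbacks CC) (p : forall S, pre_structure kp sp S) :
  (forall (S T : SpanOb CC) (f : SpanHom S T),
    preserves_p (X := ps_pregroupoid (p S)) (Y := ps_pregroupoid (p T)) f) ->
  has_section (V kp sp).
Proof.
move=> hp.
pose F (S : Span CC) : PreGrpd kp sp := ps_pregroupoid (p S).
pose mF (S T : Span CC) (f : Hom S T) : Hom (F S) (F T) := exist _ f (hp S T f).
have F1 (S : Span CC) : mF S S (idm S) = idm (F S) by exact: sig_eq.
have FM (S T W : Span CC) (g : Hom T W) (f : Hom S T) :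
    mF S W (g ∘ f) = mF T W g ∘ mF S T f by exact: sig_eq.
exists (MkFunctor F1 FM).
by apply: (@functor_eq _ _ (functor_comp (V kp sp) (MkFunctor F1 FM))
  (functor_id (Span CC)) (fun S => eq_refl)).
Qed.

(** * The reflexive graph of triples *)

Section TripleGraph.

Context (CC : Category) (kp : has_kernel_pairs CC) (sp : has_split_pullbacks CC).

Lemma diag_d (S : SpanOb CC) : triple3 kp sp S ∘ triple kp sp
  (eq_refl (sp_d S ∘ idm (spD S))) (eq_refl (sp_c S ∘ idm (spD S))) = idm (spD S).
Proof. exact: triple3_triple. Qed.

Lemma diag_c (S : SpanOb CC) : triple1 kp sp S ∘ triple kp sp
  (eq_refl (sp_d S ∘ idm (spD S))) (eq_refl (sp_c S ∘ idm (spD S))) = idm (spD S).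
Proof. exact: triple1_triple. Qed.

(** A triple (x, y, z) is an arrow from z to x, and (x, x, x) is the identity on x. *)
Definition triple_graph (S : SpanOb CC) : ReflGraph CC :=
  MkReflGraph (diag_d S) (diag_c S).

Section TriplesMap.

Context (S T : SpanOb CC) (f : SpanHom S T).

Lemma triple_graph_map_e :
  triples_map kp sp f ∘ rg_e (triple_graph S) = rg_e (triple_graph T) ∘ sph f.
Proof. by apply: triples_ext; rewrite /= ?tripleE. Qed.

Definition triple_graph_map : RGHom (triple_graph S) (triple_graph T) :=
  @MkRGHom _ (triple_graph S) (triple_graph T) (triples_map kp sp f) (sph f)
    (triple3_map kp sp f) (triple1_map kp sp f) triple_graph_map_e.

End TriplesMap.

(** With the legs exchanged, (x, x, y) and (y, z, z) are arrows whenever d x = d y and c y = c z. *)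
Definition swap_span (S : SpanOb CC) : SpanOb CC := MkSpan (sp_c S) (sp_d S).

Definition swap_span_map (S T : SpanOb CC) (f : SpanHom S T) :
  SpanHom (swap_span S) (swap_span T) :=
  @MkSpanHom _ (swap_span S) (swap_span T) (sph f) (sph0' f) (sph0 f)
    (sph_c f) (sph_d f).

Section ArrowPair.

Context (S : SpanOb CC).
Let G := triple_graph (swap_span S).

Definition arrow_l : Hom (triples kp sp S) (triples kp sp (swap_span S)) :=
  @triple _ kp sp (swap_span S) _ (triple1 kp sp S) (triple1 kp sp S)
    (triple2 kp sp S) eq_refl (triple_d kp sp S).

Definition arrow_r : Hom (triples kp sp S) (triples kp sp (swap_span S)) :=
  @triple _ kp sp (swap_span S) _ (triple2 kp sp S) (triple3 kp sp S)
    (triple3 kp sp S) (triple_c kp sp S) eq_refl.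

Lemma arrow_pair_comm : rg_d G ∘ arrow_l = rg_c G ∘ arrow_r.
Proof. by rewrite /= triple1_triple triple3_triple. Qed.

Definition arrow_pair : Hom (triples kp sp S) (composable sp G) :=
  pb_pair (composable sp G) arrow_l arrow_r arrow_pair_comm.

Context (m : mult_structure sp G).

(* [(x, y, z)], with [d x = d y] and [c y = c z], is sent to the middle component
   of the composite [(x, x, y) (y, z, z)] of arrows [z -> y -> x]. *)
Definition middle_composite : Hom (triples kp sp S) (spD S) :=
  triple2 kp sp (swap_span S) ∘ (ms_m m ∘ arrow_pair).

(** On (x, y, y) the second arrow is the identity (y, y, y), so the composite is (x, x, y), with
    middle component x. *)
Lemma middle_composite_i1 :
  middle_composite ∘ pre_i1 kp sp S = pb1 (kerd kp S).
Proof.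
rewrite /middle_composite -compA -(compA (ms_m m)).
have -> : arrow_pair ∘ pre_i1 kp sp S =
    pb_in1 (composable sp G) (rg_ce G) ∘ (arrow_l ∘ pre_i1 kp sp S).
  apply: pb_ext; rewrite /arrow_pair /pb_in1 ?pbE //.
  by apply: triple_comp_eq; rewrite /= ?tripleE.
rewrite (compA (ms_m m)) ms_e1 comp1m.
transitivity (triple1 kp sp S ∘ pre_i1 kp sp S); last by rewrite tripleE.
exact: (@triple2_tripleA _ kp sp (swap_span S)).
Qed.

Lemma middle_composite_i2 :
  middle_composite ∘ pre_i2 kp sp S = pb2 (kerc kp S).
Proof.
rewrite /middle_composite -compA -(compA (ms_m m)).
have -> : arrow_pair ∘ pre_i2 kp sp S =
    pb_in2 (composable sp G) (rg_de G) ∘ (arrow_r ∘ pre_i2 kp sp S).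
  apply: pb_ext; rewrite /arrow_pair /pb_in2 ?pbE //.
  by apply: triple_comp_eq; rewrite /= ?tripleE.
rewrite (compA (ms_m m)) ms_e2 comp1m.
transitivity (triple3 kp sp S ∘ pre_i2 kp sp S); last by rewrite tripleE.
exact: (@triple2_tripleA _ kp sp (swap_span S)).
Qed.

(** The composite is a triple of the swapped span with third component z, and [d] agrees on its
    middle and third components. *)
Lemma middle_composite_d :
  sp_d S ∘ middle_composite =
  sp_d S ∘ (pb2 (kerc kp S) ∘ pb2 (triples kp sp S)).
Proof.
have e w : sp_d S ∘ (triple2 kp sp (swap_span S) ∘ w) =
    sp_d S ∘ (rg_d G ∘ w).
  by rewrite compA [RHS]compA;
    exact: (f_equal (fun v => v ∘ w) (triple_c kp sp (swap_span S))).
rewrite /middle_composite e.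
rewrite (compA (rg_d G)) (ms_dm m) -compA pb2_pair.
congr (_ ∘ _); exact: (@triple3_triple _ kp sp (swap_span S)).
Qed.

Lemma middle_composite_c :
  sp_c S ∘ middle_composite =
  sp_c S ∘ (pb1 (kerd kp S) ∘ pb1 (triples kp sp S)).
Proof.
have e w : sp_c S ∘ (triple2 kp sp (swap_span S) ∘ w) =
    sp_c S ∘ (rg_c G ∘ w).
  by rewrite compA [RHS]compA;
    exact: (f_equal (fun v => v ∘ w) (eq_sym (triple_d kp sp (swap_span S)))).
rewrite /middle_composite e.
rewrite (compA (rg_c G)) (ms_cm m) -compA pb1_pair.
congr (_ ∘ _); exact: (@triple1_triple _ kp sp (swap_span S)).
Qed.

Definition middle_structure : pre_structure kp sp S :=
  PreStructure middle_composite_i1 middle_composite_i2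
    middle_composite_d middle_composite_c.

End ArrowPair.

(** A span morphism acts componentwise on triples, hence carries the arrow pairs of [S] to those of
    [T]; preservation of composites then passes to middle components. *)
Lemma middle_structure_preserved (S T : SpanOb CC) (f : SpanHom S T)
  (m : mult_structure sp (triple_graph (swap_span S)))
  (m' : mult_structure sp (triple_graph (swap_span T))) :
  preserves_mult (X := ms_graph m) (Y := ms_graph m')
    (triple_graph_map (swap_span_map f)) ->
  preserves_p (X := ps_pregroupoid (middle_structure m))
    (Y := ps_pregroupoid (middle_structure m')) f.
Proof.
move=> hm; rewrite /preserves_p /= /middle_composite.
transitivity (triple2 kp sp (swap_span T) ∘
  (triples_map kp sp (swap_span_map f) ∘ (ms_m m ∘ arrow_pair S))).
  exact: (eq_sym (triple2_mapA (swap_span_map f) _)).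
rewrite (compA (triples_map _ _ _)) [triples_map _ _ _ ∘ ms_m m]hm.
rewrite -[RHS]compA -[_ ∘ arrow_pair T ∘ _]compA -[_ ∘ arrow_pair S]compA.
congr (triple2 kp sp (swap_span T) ∘ (ms_m m' ∘ _)).
apply: pb_ext; rewrite /arrow_pair /pb_map ?pbE.
- by apply: (@triples_map_triple _ kp sp _ _ (swap_span_map f)); rewrite /= ?tripleE.
- by apply: (@triples_map_triple _ kp sp _ _ (swap_span_map f)); rewrite /= ?tripleE.
Qed.

End TripleGraph.

Lemma section_V_of_U1 (CC : Category) (kp : has_kernel_pairs CC)
  (sp : has_split_pullbacks CC) : has_section (U1 sp) -> has_section (V kp sp).
Proof.
case/section_U1_structure => m hm.
apply: (@structure_section_V _ _ _
  (fun S => middle_structure (m (triple_graph kp sp (swap_span S))))) => S T f.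
exact/middle_structure_preserved/hm.
Qed.

(** * The extension property *)

Definition extension_property (CC : Category) (sp : has_split_pullbacks CC) :
  Prop :=
  forall (A B C D : CC) (f : Hom A B) (r : Hom B A) (g : Hom C B) (s : Hom B C)
    (alpha : Hom A D) (beta : Hom B D) (gamma : Hom C D)
    (hr : f ∘ r = idm B) (hs : g ∘ s = idm B),
    alpha ∘ r = beta -> gamma ∘ s = beta ->
    forall (D0 D0' : CC) (d : Hom D D0) (c : Hom D D0'),
    d ∘ alpha = d ∘ (beta ∘ f) -> c ∘ gamma = c ∘ (beta ∘ g) ->
    let P := sp A C B f g (split_epi_intro hr) (split_epi_intro hs) in
    exists! phi : Hom (pb_obj P) D,
      phi ∘ pb_in1 P hs = alpha /\
      phi ∘ pb_in2 P hr = gamma /\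
      d ∘ phi = d ∘ (gamma ∘ pb2 P) /\
      c ∘ phi = c ∘ (alpha ∘ pb1 P).

Lemma extension_of_section_V (CC : Category) (kp : has_kernel_pairs CC)
  (sp : has_split_pullbacks CC) :
  has_section (V kp sp) -> extension_property sp.
Proof.
case/section_V_structure => p hp A B C D f r g s al be ga hr hs hal hga D0 D0' d c
  hd hc P.
pose X := ps_pregroupoid (p (MkSpan d c)).
have dxy : d ∘ (al ∘ pb1 P) = d ∘ (be ∘ (f ∘ pb1 P)).
  by rewrite compA hd -!compA.
have cyz : c ∘ (be ∘ (f ∘ pb1 P)) = c ∘ (ga ∘ pb2 P).
  by rewrite (compA c ga) hc -!compA pb_comm.
exists (@app_p _ _ _ X _ _ _ _ dxy cyz); split.
- split; last split; last split.
  + rewrite (@app_p_comp_xyy _ _ _ X) /pb_in1 ?pbE //.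
    by rewrite -hga ?pbE.
  + rewrite (@app_p_comp_xxy _ _ _ X) /pb_in2 ?pbE //.
    by rewrite -hal -(compA al) (compA f) hr comp1m.
  + exact: (@app_p_d _ _ _ X).
  + exact: (@app_p_c _ _ _ X).
- move=> phi [e1 [e2 [edphi ecphi]]].
  (* [phi] is a morphism of spans, and [(a, c) = p((a, s b), (r b, s b), (r b, c))]
     in the span of the projections of the pullback, where [b = f a = g c]. *)
  pose S' := MkSpan (pb2 P) (pb1 P); pose X' := ps_pregroupoid (p S').
  have h1 : sp_d (MkSpan d c) ∘ phi = (d ∘ ga) ∘ sp_d S' by rewrite /= edphi compA.
  have h2 : sp_c (MkSpan d c) ∘ phi = (c ∘ al) ∘ sp_c S' by rewrite /= ecphi compA.
  pose F : SpanHom S' (MkSpan d c) :=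
    @MkSpanHom _ S' (MkSpan d c) phi (d ∘ ga) (c ∘ al) h1 h2.
  pose x : Hom P P := pb_in1 P hs ∘ pb1 P.
  pose y : Hom P P := pb_in1 P hs ∘ (r ∘ (f ∘ pb1 P)).
  pose z : Hom P P := pb_in2 P hr ∘ pb2 P.
  have rE (W : CC) (w : Hom W B) : f ∘ (r ∘ w) = w by rewrite compA hr comp1m.
  have dxy' : sp_d X' ∘ x = sp_d X' ∘ y.
    by rewrite /= /x /y /pb_in1 ?pbE rE.
  have cyz' : sp_c X' ∘ y = sp_c X' ∘ z.
    by rewrite /= /z /y /pb_in1 /pb_in2 ?pbE pb_comm.
  (* In this span the laws for the two legs alone determine both projections of p(x, y, z). *)
  have e : app_p X' x y z dxy' cyz' = idm P.
    apply: pb_ext; first by rewrite [LHS](@app_p_c _ _ _ X') /= /x /pb_in1 ?pbE.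
    by rewrite [LHS](@app_p_d _ _ _ X') /= /z /pb_in2 ?pbE.
  have ex : phi ∘ x = al ∘ pb1 P by rewrite /x compA e1.
  have ey : phi ∘ y = be ∘ (f ∘ pb1 P) by rewrite /y compA e1 (compA al) hal.
  have ez : phi ∘ z = ga ∘ pb2 P by rewrite /z compA e2.
  (* As [phi] preserves the operation, phi = phi p(x, y, z) = p(phi x, phi y, phi z), which is the
     solution already found. *)
  rewrite -(compm1 phi) -e; symmetry.
  have dxy'' : d ∘ (phi ∘ x) = d ∘ (phi ∘ y) by rewrite ex ey.
  have cyz'' : c ∘ (phi ∘ y) = c ∘ (phi ∘ z) by rewrite ey ez.
  rewrite (@app_p_preserved _ _ _ X' X F _ _ _ _ _ _ dxy'' cyz'' (hp _ _ F)).
  exact: (@app_p_eq _ _ _ X).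
Qed.

Section Extension.

Context (CC : Category) (sp : has_split_pullbacks CC)
  (hv : extension_property sp).

Section Unique.

Context (A B C D : CC) (f : Hom A B) (r : Hom B A) (g : Hom C B) (s : Hom B C).
Context (hr : f ∘ r = idm B) (hs : g ∘ s = idm B).
Context (hf : split_epi f) (hg : split_epi g).
Let P := sp hf hg.

(** The chosen pullback depends on the proofs that its legs split; proof irrelevance extends the
    property to arbitrary such proofs, as occur in [triples]. *)
Lemma extension_exists (alpha : Hom A D) (beta : Hom B D) (gamma : Hom C D)
  (D0 D0' : CC) (d : Hom D D0) (c : Hom D D0') :
  alpha ∘ r = beta -> gamma ∘ s = beta ->
  d ∘ alpha = d ∘ (beta ∘ f) -> c ∘ gamma = c ∘ (beta ∘ g) ->
  exists phi : Hom P D, phi ∘ pb_in1 P hs = alpha /\ phi ∘ pb_in2 P hr = gamma /\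
    d ∘ phi = d ∘ (gamma ∘ pb2 P) /\ c ∘ phi = c ∘ (alpha ∘ pb1 P).
Proof.
rewrite /P (proof_irrelevance _ hf (split_epi_intro hr))
  (proof_irrelevance _ hg (split_epi_intro hs)) => hal hga hd hc.
by have [phi [h _]] := hv hr hs hal hga hd hc; exists phi.
Qed.

(** The data alpha, gamma and beta are read off [phi] as its restrictions. Restricting along
    [pb_in2] and [pb_in1] shows that [delta] is d gamma and [kappa] is c alpha, so common
    factorisations suffice. *)
Lemma extension_unique (D0 D0' : CC) (d : Hom D D0) (c : Hom D D0')
  (delta : Hom C D0) (kappa : Hom A D0') (phi psi : Hom P D) :
  phi ∘ pb_in1 P hs = psi ∘ pb_in1 P hs ->
  phi ∘ pb_in2 P hr = psi ∘ pb_in2 P hr ->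
  d ∘ phi = delta ∘ pb2 P -> c ∘ phi = kappa ∘ pb1 P ->
  d ∘ psi = delta ∘ pb2 P -> c ∘ psi = kappa ∘ pb1 P -> phi = psi.
Proof.
move: phi psi; rewrite /P (proof_irrelevance _ hf (split_epi_intro hr))
  (proof_irrelevance _ hg (split_epi_intro hs)).
set Q := sp _ _ => phi psi e1 e2 dphi cphi dpsi cpsi.
(* Both sides send b to (r b, s b), so the two restrictions agree on [B]. *)
have e12 : pb_in1 Q hs ∘ r = pb_in2 Q hr ∘ s.
  by apply: pb_ext; rewrite /pb_in1 /pb_in2 ?pbE ?hr ?hs ?pbE.
have dE (w : Hom Q D) : d ∘ w = delta ∘ pb2 Q ->
    d ∘ w = d ∘ ((w ∘ pb_in2 Q hr) ∘ pb2 Q).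
  by move=> dw; rewrite compA (compA d w) dw -(compA delta) /pb_in2 ?pbE.
have cE (w : Hom Q D) : c ∘ w = kappa ∘ pb1 Q ->
    c ∘ w = c ∘ ((w ∘ pb_in1 Q hs) ∘ pb1 Q).
  by move=> cw; rewrite compA (compA c w) cw -(compA kappa) /pb_in1 ?pbE.
have hga : (phi ∘ pb_in2 Q hr) ∘ s = (phi ∘ pb_in1 Q hs) ∘ r.
  by rewrite -!compA e12.
have hd : d ∘ (phi ∘ pb_in1 Q hs) = d ∘ ((phi ∘ pb_in1 Q hs) ∘ r ∘ f).
  by rewrite -hga !compA dphi /pb_in1 /pb_in2 ?pbE.
have hc : c ∘ (phi ∘ pb_in2 Q hr) = c ∘ ((phi ∘ pb_in1 Q hs) ∘ r ∘ g).
  by rewrite !compA cphi /pb_in1 /pb_in2 ?pbE.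
have [chi [_ u]] := hv hr hs eq_refl hga hd hc.
have ephi : chi = phi.
  by apply: u; split=> //; split=> //; split; [exact: dE | exact: cE].
have epsi : chi = psi.
  apply: u; split; first by rewrite e1.
  by split; first (by rewrite e2); split; rewrite ?e1 ?e2; [exact: dE | exact: cE].
by rewrite -ephi.
Qed.

End Unique.

(** * Multiplicative graphs *)

(** For alpha = gamma = 1 and beta = e over the span (d, c), the conditions on the extension are the
    laws of a multiplication. *)
Lemma extension_mult_structure (G : ReflGraph CC) :
  exists X : MultGraph sp, mg_graph X = G.
Proof.
have hd : rg_d G ∘ idm (rg1 G) = rg_d G ∘ (rg_e G ∘ rg_d G).
  by rewrite compA rg_de comp1m compm1.
have hc : rg_c G ∘ idm (rg1 G) = rg_c G ∘ (rg_e G ∘ rg_c G).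
  by rewrite compA rg_ce comp1m compm1.
have [m [e1 [e2 [dm cm]]]] :=
  extension_exists (rg_de G) (rg_ce G) (split_epi_intro (rg_de G))
    (split_epi_intro (rg_ce G)) (comp1m _) (comp1m _) hd hc.
rewrite !comp1m in dm cm.
by exists (@MkMultGraph _ sp G m e1 e2 dm cm).
Qed.

(** By the unit laws both composites restrict to [rgh1 f] along [pb_in1] and [pb_in2]. *)
Lemma extension_preserves_mult (X Y : MultGraph sp) (f : RGHom X Y) :
  preserves_mult f.
Proof.
apply: (extension_unique (hr := rg_de X) (hs := rg_ce X)
  (d := rg_d Y) (c := rg_c Y)
  (delta := rg_d Y ∘ rgh1 f) (kappa := rg_c Y ∘ rgh1 f)).
- have e : pb_map (composable sp X) (composable sp Y) (rgh1 f) (rgh1 f) (rgh0 f)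
      (rgh_d f) (rgh_c f) ∘ pb_in1 (composable sp X) (rg_ce X) =
      pb_in1 (composable sp Y) (rg_ce Y) ∘ rgh1 f.
    apply: pb_ext; rewrite /pb_map /pb_in1 ?pbE //.
    by rewrite compA rgh_e -compA -rgh_d.
  by rewrite -!compA e mg_e1 compA mg_e1 comp1m compm1.
- have e : pb_map (composable sp X) (composable sp Y) (rgh1 f) (rgh1 f) (rgh0 f)
      (rgh_d f) (rgh_c f) ∘ pb_in2 (composable sp X) (rg_de X) =
      pb_in2 (composable sp Y) (rg_de Y) ∘ rgh1 f.
    apply: pb_ext; rewrite /pb_map /pb_in2 ?pbE //.
    by rewrite compA rgh_e -compA -rgh_c.
  by rewrite -!compA e mg_e2 compA mg_e2 comp1m compm1.
- by rewrite compA rgh_d -compA mg_dm !compA.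
- by rewrite compA rgh_c -compA mg_cm !compA.
- by rewrite compA mg_dm /pb_map ?pbE.
- by rewrite compA mg_cm /pb_map ?pbE.
Qed.

Lemma MultGraph_eq (X Y : MultGraph sp) : mg_graph X = mg_graph Y -> X = Y.
Proof.
case: X Y => [G m e1 e2 dm cm] [H n e1' e2' dn cn] /= e; subst H.
suff emn : m = n by subst n; f_equal; apply: proof_irrelevance.
apply: (extension_unique (hr := rg_de G) (hs := rg_ce G)
  (d := rg_d G) (c := rg_c G) (delta := rg_d G) (kappa := rg_c G)) => //.
- by rewrite [LHS]e1 [RHS]e1'.
- by rewrite [LHS]e2 [RHS]e2'.
Qed.

Lemma U1_bijective : bijective_on_objects (U1 sp).
Proof.
move=> G; have [X eX] := extension_mult_structure G.
by exists X; split=> // Y eY; apply: MultGraph_eq; rewrite [RHS]eY.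
Qed.

Lemma U1_fully_faithful : fully_faithful (U1 sp).
Proof. exact/over_forget_fully_faithful/extension_preserves_mult. Qed.

(** Composable triples again form a pullback of split epimorphisms, whose injections insert an
    identity in third or first place. Both bracketings give x y on (x, y, 1) and y z on (1, y,
    z). *)
Lemma extension_internal_category (X : MG sp) : is_internal_category X.
Proof.
rewrite /is_internal_category.
have hr : pb2 (composable sp X) ∘ pb_in2 (composable sp X) (rg_de X) = idm _.
  exact: pb2_pair.
have hs : pb1 (composable sp X) ∘ pb_in1 (composable sp X) (rg_ce X) = idm _.
  exact: pb1_pair.
apply: (extension_unique (hr := hr) (hs := hs) (d := rg_d X) (c := rg_c X)
  (delta := rg_d X ∘ pb2 (composable sp X))
  (kappa := rg_c X ∘ pb1 (composable sp X))).
- rewrite -!compA.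
  have -> : one_times_m X ∘ pb_in1 (composable3 sp X) hs = idm _.
    apply: pb_ext; rewrite /one_times_m {1}/pb_in1 ?pbE //.
    by rewrite compA mg_e1 comp1m.
  have -> : m_times_one X ∘ pb_in1 (composable3 sp X) hs =
      pb_in1 (composable sp X) (rg_ce X) ∘ mg_m X.
    apply: pb_ext; rewrite /m_times_one /pb_in1 ?pbE //.
    by rewrite -mg_dm.
  by rewrite compm1 compA mg_e1 comp1m.
- rewrite -!compA.
  have -> : one_times_m X ∘ pb_in2 (composable3 sp X) hr =
      pb_in2 (composable sp X) (rg_de X) ∘ mg_m X.
    apply: pb_ext; rewrite /one_times_m /pb_in2 ?pbE //.
    by rewrite -mg_cm.
  have -> : m_times_one X ∘ pb_in2 (composable3 sp X) hr = idm _.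
    apply: pb_ext; rewrite /m_times_one {1}/pb_in2 ?pbE //.
    by rewrite compA mg_e2 comp1m.
  by rewrite compm1 compA mg_e2 comp1m.
- by rewrite compA mg_dm /one_times_m ?pbE [LHS]compA mg_dm ?pbE.
- by rewrite compA mg_cm /one_times_m ?pbE.
- by rewrite compA mg_dm /m_times_one ?pbE.
- by rewrite compA mg_cm /m_times_one ?pbE [LHS]compA mg_cm ?pbE.
Qed.

(** * Pregroupoids *)

Context (kp : has_kernel_pairs CC).

Section Span.

Context (S : SpanOb CC).

Definition kerd_diag : Hom (spD S) (kerd kp S) :=
  pb_pair (kerd kp S) (idm _) (idm _) eq_refl.

Definition kerc_diag : Hom (spD S) (kerc kp S) :=
  pb_pair (kerc kp S) (idm _) (idm _) eq_refl.

Lemma kerd_diagK : pb2 (kerd kp S) ∘ kerd_diag = idm (spD S).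
Proof. exact: pb2_pair. Qed.

Lemma kerc_diagK : pb1 (kerc kp S) ∘ kerc_diag = idm (spD S).
Proof. exact: pb1_pair. Qed.

(** With the diagonals as sections, the extension property thus speaks about the unit laws of
    pregroupoids. *)
Lemma pre_i1E : pre_i1 kp sp S = pb_in1 (triples kp sp S) kerc_diagK.
Proof.
apply: pb_pair_eq => //.
by apply: pb_ext; rewrite /kerc_diag ?pbE.
Qed.

Lemma pre_i2E : pre_i2 kp sp S = pb_in2 (triples kp sp S) kerd_diagK.
Proof.
apply: pb_pair_eq => //.
by apply: pb_ext; rewrite /kerd_diag ?pbE.
Qed.

(** Taking [h] to be [sph f] yields preservation of the operation, and the identity yields its
    uniqueness. *)
Lemma pregroupoid_unique (T : SpanOb CC) (h : Hom (spD S) (spD T))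
  (phi psi : Hom (triples kp sp S) (spD T)) :
  phi ∘ pre_i1 kp sp S = psi ∘ pre_i1 kp sp S ->
  phi ∘ pre_i2 kp sp S = psi ∘ pre_i2 kp sp S ->
  sp_d T ∘ phi = sp_d T ∘ (h ∘ triple3 kp sp S) ->
  sp_c T ∘ phi = sp_c T ∘ (h ∘ triple1 kp sp S) ->
  sp_d T ∘ psi = sp_d T ∘ (h ∘ triple3 kp sp S) ->
  sp_c T ∘ psi = sp_c T ∘ (h ∘ triple1 kp sp S) -> phi = psi.
Proof.
rewrite pre_i1E pre_i2E => e1 e2 dphi cphi dpsi cpsi.
apply: (extension_unique (hr := kerd_diagK) (hs := kerc_diagK)
  (d := sp_d T) (c := sp_c T)
  (delta := sp_d T ∘ (h ∘ pb2 (kerc kp S)))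
  (kappa := sp_c T ∘ (h ∘ pb1 (kerd kp S)))) => //.
- by rewrite dphi -!compA.
- by rewrite cphi -!compA.
- by rewrite dpsi -!compA.
- by rewrite cpsi -!compA.
Qed.

(** This is the extension of alpha = d_1, beta = 1 and gamma = c_2. *)
Lemma extension_pre_structure :
  inhabited (pre_structure kp sp S).
Proof.
have hal : pb1 (kerd kp S) ∘ kerd_diag = idm (spD S) by exact: pb1_pair.
have hga : pb2 (kerc kp S) ∘ kerc_diag = idm (spD S) by exact: pb2_pair.
have hd : sp_d S ∘ pb1 (kerd kp S) = sp_d S ∘ (idm _ ∘ pb2 (kerd kp S)).
  by rewrite comp1m pb_comm.
have hc : sp_c S ∘ pb2 (kerc kp S) = sp_c S ∘ (idm _ ∘ pb1 (kerc kp S)).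
  by rewrite comp1m pb_comm.
have [p [i1 [i2 [dp cp]]]] := extension_exists kerd_diagK kerc_diagK
  (kernel_pair_pb2_split (kerd kp S)) (kernel_pair_pb1_split (kerc kp S))
  hal hga hd hc.
rewrite -pre_i1E in i1; rewrite -pre_i2E in i2.
by split; exists p.
Qed.

End Span.

Lemma extension_preserves_p (X Y : Pregroupoid kp sp) (f : SpanHom X Y) :
  preserves_p f.
Proof.
apply: (@pregroupoid_unique X Y (sph f)).
- have -> : pg_p Y ∘ triples_map kp sp f ∘ pre_i1 kp sp X =
      pg_p Y ∘ pre_i1 kp sp Y ∘ kerd_map kp f.
    rewrite -!compA; congr (_ ∘ _).
    by apply: pb_ext; apply: pb_ext;
      rewrite /triples_map /kerd_map /kerc_map /pre_i1 /pb_map ?pbE.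
  by rewrite -compA pg_i1 pg_i1 /kerd_map pb1_pair.
- have -> : pg_p Y ∘ triples_map kp sp f ∘ pre_i2 kp sp X =
      pg_p Y ∘ pre_i2 kp sp Y ∘ kerc_map kp f.
    rewrite -!compA; congr (_ ∘ _).
    by apply: pb_ext; apply: pb_ext;
      rewrite /triples_map /kerd_map /kerc_map /pre_i2 /pb_map ?pbE.
  by rewrite -compA pg_i2 pg_i2 /kerc_map pb2_pair.
- by rewrite compA sph_d -compA pg_d [RHS]compA sph_d -[RHS]compA.
- by rewrite compA sph_c -compA pg_c [RHS]compA sph_c -[RHS]compA.
- by rewrite compA pg_d -(triple3_map kp sp f) -!compA.
- by rewrite compA pg_c -(triple1_map kp sp f) -!compA.
Qed.

Lemma Pregroupoid_eq (X Y : Pregroupoid kp sp) : pg_span X = pg_span Y -> X = Y.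
Proof.
case: X Y => [S p i1 i2 dp cp] [T q i1' i2' dq cq] /= e; subst T.
suff epq : p = q by subst q; f_equal; apply: proof_irrelevance.
by apply: (@pregroupoid_unique S S (idm _)); rewrite ?comp1m ?i1 ?i2.
Qed.

Lemma V_bijective : bijective_on_objects (V kp sp).
Proof.
move=> S; have [p] := extension_pre_structure S.
by exists (ps_pregroupoid p); split=> // Y eY; apply: Pregroupoid_eq; rewrite [RHS]eY.
Qed.

Lemma V_fully_faithful : fully_faithful (V kp sp).
Proof. exact/over_forget_fully_faithful/extension_preserves_p. Qed.

(** It suffices to compare the two sides on the universal pair of triples (x, y, z) and (z, u, v)
    sharing z, a pullback of morphisms split by the diagonal. *)
Lemma extension_associative (X : Pregroupoid kp sp) : associative X.
Proof.
move=> T x y z u v dxy cyz dzu cuv dpu cyp.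
have diag : sp_d X ∘ idm (spD X) = sp_d X ∘ idm (spD X) by [].
have diag' : sp_c X ∘ idm (spD X) = sp_c X ∘ idm (spD X) by [].
pose f := triple3 kp sp X; pose g := triple1 kp sp X.
have hr : f ∘ triple kp sp diag diag' = idm _ by exact: triple3_triple.
have hs : g ∘ triple kp sp diag diag' = idm _ by exact: triple1_triple.
pose P := sp (split_epi_intro hr) (split_epi_intro hs).
have fgP : f ∘ pb1 P = g ∘ pb2 P := pb_comm P.
pose x' := triple1 kp sp X ∘ pb1 P; pose y' := triple2 kp sp X ∘ pb1 P.
pose u' := triple2 kp sp X ∘ pb2 P; pose v' := triple3 kp sp X ∘ pb2 P.
have dxy' : sp_d X ∘ x' = sp_d X ∘ y' by rewrite /x' /y' compA triple_d -compA.
have cuv' : sp_c X ∘ u' = sp_c X ∘ v' by rewrite /u' /v' compA triple_c -compA.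
have dpu' : sp_d X ∘ (pg_p X ∘ pb1 P) = sp_d X ∘ u'.
  rewrite compA pg_d -compA -[_ ∘ pb1 P]/(f ∘ pb1 P) fgP compA.
  by rewrite [_ ∘ g]triple_d -compA.
have cyp' : sp_c X ∘ y' = sp_c X ∘ (pg_p X ∘ pb2 P).
  rewrite [RHS]compA pg_c -compA -[_ ∘ pb2 P]/(g ∘ pb2 P) -fgP.
  by rewrite /y' compA triple_c -compA.
pose wA := triple kp sp dxy cyz; pose wC := triple kp sp dzu cuv.
have hw : f ∘ wA = g ∘ wC.
  by rewrite [LHS]triple3_triple [RHS]triple1_triple.
pose w := pb_pair P wA wC hw.
have -> : app_p X (app_p X x y z dxy cyz) u v dpu cuv =
    app_p X (pg_p X ∘ pb1 P) u' v' dpu' cuv' ∘ w.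
  symmetry; apply: app_p_comp; rewrite /u' /v' /w ?pbE //;
    rewrite ?tripleE //.
have -> : app_p X x y (app_p X z u v dzu cuv) dxy cyp =
    app_p X x' y' (pg_p X ∘ pb2 P) dxy' cyp' ∘ w.
  symmetry; apply: app_p_comp; rewrite /x' /y' /w ?pbE //;
    rewrite ?tripleE //.
congr (_ ∘ w).
have pdiag : pg_p X ∘ triple kp sp diag diag' = idm _.
  exact: (@app_p_xxy _ _ _ X _ _ _ _ diag diag').
have pE : app_p X _ _ _ (triple_d kp sp X) (triple_c kp sp X) = pg_p X.
  by rewrite -[RHS]compm1; apply: app_pE; rewrite compm1.
have in1f : pb2 P ∘ pb_in1 P hs = triple kp sp diag diag' ∘ f by exact: pb2_pair.
have in2g : pb1 P ∘ pb_in2 P hr = triple kp sp diag diag' ∘ g by exact: pb1_pair.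
have u1 : u' ∘ pb_in1 P hs = f.
  by rewrite -[LHS]compA in1f triple2_tripleA comp1m.
have v1 : v' ∘ pb_in1 P hs = f.
  by rewrite -[LHS]compA in1f triple3_tripleA comp1m.
have x2 : x' ∘ pb_in2 P hr = g.
  by rewrite -[LHS]compA in2g triple1_tripleA comp1m.
have y2 : y' ∘ pb_in2 P hr = g.
  by rewrite -[LHS]compA in2g triple2_tripleA comp1m.
apply: (extension_unique (hr := hr) (hs := hs) (d := sp_d X) (c := sp_c X)
  (delta := sp_d X ∘ triple3 kp sp X) (kappa := sp_c X ∘ triple1 kp sp X)).
(* Along [pb_in1], u = v = z: both sides become p(x, y, z), the right one by p(z, z, z) = z. *)
- rewrite app_p_comp_xyy ?u1 ?v1 //.
  rewrite -compA pb1_pair compm1 -[LHS]pE; symmetry; apply: app_p_comp.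
  + by rewrite /x' -compA pb1_pair compm1.
  + by rewrite /y' -compA pb1_pair compm1.
  + by rewrite -compA pb2_pair compA pdiag comp1m.
(* Along [pb_in2], x = y = z: both sides become p(z, u, v). *)
- rewrite [RHS]app_p_comp_xxy ?x2 ?y2 //.
  rewrite -[RHS]compA pb2_pair compm1 -[RHS]pE; apply: app_p_comp.
  + by rewrite -compA pb1_pair compA pdiag comp1m.
  + by rewrite /u' -compA pb2_pair compm1.
  + by rewrite /v' -compA pb2_pair compm1.
- by rewrite app_p_d /v' compA.
- by rewrite app_p_c compA pg_c.
- by rewrite app_p_d compA pg_d.
- by rewrite app_p_c /x' compA.
Qed.

(** * Inverses *)

Definition mg_mul (X : MultGraph sp) (T : CC) (x y : Hom T (rg1 X))
  (h : rg_d X ∘ x = rg_c X ∘ y) : Hom T (rg1 X) :=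
  mg_m X ∘ pb_pair (composable sp X) x y h.

Arguments mg_mul X {T} x y h.

Lemma mg_mul_eq (X : MultGraph sp) (T : CC) (x y x' y' : Hom T (rg1 X)) h h' :
  x = x' -> y = y' -> mg_mul X x y h = mg_mul X x' y' h'.
Proof. by move=> ? ?; congr (_ ∘ _); apply: pb_pair_eq. Qed.

Lemma mg_mul_comp (X : MultGraph sp) (T T' : CC) (x y : Hom T (rg1 X)) h
  (w : Hom T' T) (x' y' : Hom T' (rg1 X)) h' :
  x ∘ w = x' -> y ∘ w = y' -> mg_mul X x y h ∘ w = mg_mul X x' y' h'.
Proof.
by move=> ? ?; rewrite /mg_mul -compA; congr (_ ∘ _); apply: pb_ext;
  rewrite ?pbE.
Qed.

Lemma mg_mul_xe (X : MultGraph sp) (T : CC) (x y : Hom T (rg1 X)) h :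
  y = rg_e X ∘ (rg_d X ∘ x) -> mg_mul X x y h = x.
Proof.
move=> ey; rewrite -[RHS]comp1m -(mg_e1 X) -compA; congr (_ ∘ _).
by apply: pb_ext; rewrite /pb_in1 ?pbE.
Qed.

Lemma mg_mul_ey (X : MultGraph sp) (T : CC) (x y : Hom T (rg1 X)) h :
  x = rg_e X ∘ (rg_c X ∘ y) -> mg_mul X x y h = y.
Proof.
move=> ex; rewrite -[RHS]comp1m -(mg_e2 X) -compA; congr (_ ∘ _).
by apply: pb_ext; rewrite /pb_in2 ?pbE.
Qed.

Lemma mg_mul_d (X : MultGraph sp) (T : CC) (x y : Hom T (rg1 X)) h :
  rg_d X ∘ mg_mul X x y h = rg_d X ∘ y.
Proof. by rewrite compA mg_dm ?pbE. Qed.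

Lemma mg_mul_c (X : MultGraph sp) (T : CC) (x y : Hom T (rg1 X)) h :
  rg_c X ∘ mg_mul X x y h = rg_c X ∘ x.
Proof. by rewrite compA mg_cm ?pbE. Qed.

Lemma mg_mulA (X : MultGraph sp) (T : CC) (x y z : Hom T (rg1 X)) hxy hyz h h' :
  mg_mul X x (mg_mul X y z hyz) h = mg_mul X (mg_mul X x y hxy) z h'.
Proof.
have hp : pb2 (composable sp X) ∘ pb_pair (composable sp X) x y hxy =
    pb1 (composable sp X) ∘ pb_pair (composable sp X) y z hyz.
  by rewrite pb1_pair pb2_pair.
have -> : mg_mul X x (mg_mul X y z hyz) h =
    mg_m X ∘ one_times_m X ∘ pb_pair (composable3 sp X) _ _ hp.
  rewrite -compA; congr (_ ∘ _).
  by apply: pb_ext; rewrite /one_times_m ?pbE.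
rewrite (extension_internal_category X) -compA; congr (_ ∘ _).
by apply: pb_ext; rewrite /m_times_one ?pbE.
Qed.

(* In the span of the maps [(y, x) |-> source of x] and [(y, x) |-> y] on composable
   pairs, [p((x, 1), (1, x), (1, 1))] has first component [x]. Multiplication is a
   morphism from this span to [(d, c)], so it sends this pair to [p(x, x, 1) = 1]:
   the second component is a right inverse of [x]. *)
Lemma extension_right_inverse (X : MultGraph sp) :
  exists (t : Hom (rg1 X) (rg1 X)) (ct : rg_c X ∘ t = rg_d X),
    rg_d X ∘ t = rg_c X /\
    mg_mul X (idm (rg1 X)) t (pair_one_t_comm ct) = rg_e X ∘ rg_c X.
Proof.
set C2 := composable sp X.
pose T : SpanOb CC := MkSpan (rg_d X) (rg_c X).
pose S : SpanOb CC := MkSpan (rg_d X ∘ pb2 C2) (pb1 C2).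
have [pS] := extension_pre_structure S; have [pT] := extension_pre_structure T.
pose Y := ps_pregroupoid pS; pose Z := ps_pregroupoid pT.
(* The laws d m(y, x) = d x and c m(y, x) = c y make multiplication a span morphism with 1 and
   [rg_c X] on the feet. *)
have hmd : sp_d T ∘ mg_m X = idm _ ∘ sp_d S by rewrite comp1m; exact: mg_dm.
have hmc : sp_c T ∘ mg_m X = rg_c X ∘ sp_c S by exact: mg_cm.
pose mu : SpanHom S T := @MkSpanHom _ S T (mg_m X) _ _ hmd hmc.
pose x1 : Hom (rg1 X) C2 := pb_in1 C2 (rg_ce X).
pose x2 : Hom (rg1 X) C2 := pb_in2 C2 (rg_de X).
pose x3 : Hom (rg1 X) C2 := x1 ∘ (rg_e X ∘ rg_c X).
have eE (W : CC) (w : Hom W (rg0 X)) : rg_d X ∘ (rg_e X ∘ w) = w.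
  by rewrite compA rg_de comp1m.
have hd : sp_d Y ∘ x1 = sp_d Y ∘ x2.
  by rewrite /= /x1 /x2 /pb_in1 /pb_in2 ?pbE eE.
have hc : sp_c Y ∘ x2 = sp_c Y ∘ x3.
  by rewrite /= /x3 /x1 /x2 /pb_in1 /pb_in2 ?pbE.
pose q := app_p Y x1 x2 x3 hd hc.
have q1 : pb1 C2 ∘ q = idm _.
  by rewrite [LHS](@app_p_c _ _ _ Y) /= /x1 /pb_in1 ?pbE.
have q2 : rg_d X ∘ (pb2 C2 ∘ q) = rg_c X.
  rewrite [LHS]compA [LHS](@app_p_d _ _ _ Y) /= /x3 /x1 /pb_in1 ?pbE.
  by rewrite !eE.
have qm : mg_m X ∘ q = rg_e X ∘ rg_c X.
  have m1 : mg_m X ∘ x1 = idm _ by exact: mg_e1.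
  have m2 : mg_m X ∘ x2 = idm _ by exact: mg_e2.
  have m3 : mg_m X ∘ x3 = rg_e X ∘ rg_c X by rewrite compA m1 comp1m.
  have hd' : sp_d Z ∘ (mg_m X ∘ x1) = sp_d Z ∘ (mg_m X ∘ x2) by rewrite m1 m2.
  have hc' : sp_c Z ∘ (mg_m X ∘ x2) = sp_c Z ∘ (mg_m X ∘ x3).
    by rewrite m2 m3 /= compA rg_ce comp1m compm1.
  rewrite [LHS](@app_p_preserved _ _ _ Y Z mu _ _ _ _ _ _ hd' hc'
    (@extension_preserves_p Y Z mu)).
  by rewrite (@app_p_xxy _ _ _ Z) // m1 m2.
have ct : rg_c X ∘ (pb2 C2 ∘ q) = rg_d X.
  by rewrite compA -pb_comm -compA q1 compm1.
exists (pb2 C2 ∘ q), ct; split=> //.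
rewrite -qm; congr (_ ∘ _).
by apply: pb_ext; rewrite ?pbE.
Qed.

(* [x = x (t x t (t x)) = (x t x) t (t x) = t (t x)], so [t x] is also a left
   inverse of [x]. *)
Lemma extension_internal_groupoid (Y : Cat sp) : is_internal_groupoid Y.
Proof.
rewrite /is_internal_groupoid; set X := proj1_sig Y.
have [t [ct [dt xt]]] := extension_right_inverse X.
exists t, ct, dt; split=> //.
have ht : rg_d X ∘ t = rg_c X ∘ (t ∘ t) by rewrite compA ct.
(* This is the right inverse law evaluated at t x. *)
have tt1 : mg_mul X t (t ∘ t) ht = rg_e X ∘ rg_d X.
  transitivity (mg_mul X (idm (rg1 X)) t (pair_one_t_comm ct) ∘ t).
    by symmetry; apply: mg_mul_comp; rewrite ?comp1m.
  by rewrite xt -compA ct.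
(* If t is an involution, the equation just obtained is the left inverse law. *)
suff ett : t ∘ t = idm _.
  rewrite -[RHS]tt1; apply: mg_mul_eq => //.
have h1 : rg_d X ∘ mg_mul X (idm (rg1 X)) t (pair_one_t_comm ct) =
    rg_c X ∘ (t ∘ t) by rewrite mg_mul_d.
have h2 : rg_d X ∘ idm (rg1 X) = rg_c X ∘ mg_mul X t (t ∘ t) ht.
  by rewrite mg_mul_c ct compm1.
have := @mg_mulA X _ _ _ _ (pair_one_t_comm ct) ht h2 h1.
rewrite (mg_mul_xe h2); first by rewrite tt1 compm1.
rewrite (mg_mul_ey h1); first by rewrite xt (compA (rg_c X)) ct dt.
by move=> <-.
Qed.

(** * Composite forgetful functors *)

Lemma U12_bijective : bijective_on_objects (U12 sp).
Proof.
apply: bijective_on_objects_comp; first exact: U1_bijective.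
exact/full_inclusion_bijective/extension_internal_category.
Qed.

Lemma U12_fully_faithful : fully_faithful (U12 sp).
Proof.
apply: fully_faithful_comp; first exact: U1_fully_faithful.
exact: full_inclusion_fully_faithful.
Qed.

Lemma U123_bijective : bijective_on_objects (U123 sp).
Proof.
apply: bijective_on_objects_comp; first exact: U12_bijective.
exact/full_inclusion_bijective/extension_internal_groupoid.
Qed.

Lemma U123_fully_faithful : fully_faithful (U123 sp).
Proof.
apply: fully_faithful_comp; first exact: U12_fully_faithful.
exact: full_inclusion_fully_faithful.
Qed.

End Extension.

(** * Equivalence of the five conditions *)

Theorem theorem2p2 (CC : Category) (kp : has_kernel_pairs CC)
  (sp : has_split_pullbacks CC) :
  let cond_i := is_isomorphism (U123 sp) in
  let cond_ii := has_section (U12 sp) in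
  let cond_iii := has_section (U1 sp) in
  let cond_iv := has_section (V kp sp) in
  let cond_v :=
    forall (A B C D : CC) (f : Hom A B) (r : Hom B A) (g : Hom C B) (s : Hom B C)
      (alpha : Hom A D) (beta : Hom B D) (gamma : Hom C D)
      (hr : f ∘ r = idm B) (hs : g ∘ s = idm B),
      alpha ∘ r = beta -> gamma ∘ s = beta ->
      forall (D0 D0' : CC) (d : Hom D D0) (c : Hom D D0'),
      d ∘ alpha = d ∘ (beta ∘ f) -> c ∘ gamma = c ∘ (beta ∘ g) ->
      let P := sp A C B f g (split_epi_intro hr) (split_epi_intro hs) in
      exists! phi : Hom (pb_obj P) D,
        phi ∘ pb_in1 P hs = alpha /\
        phi ∘ pb_in2 P hr = gamma /\
        d ∘ phi = d ∘ (gamma ∘ pb2 P) /\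
        c ∘ phi = c ∘ (alpha ∘ pb1 P) in
  ((cond_i <-> cond_ii) /\ (cond_i <-> cond_iii) /\
   (cond_i <-> cond_iv) /\ (cond_i <-> cond_v)) /\
  (cond_i ->
     is_isomorphism (U12 sp) /\
     is_isomorphism (U1 sp) /\
     is_isomorphism (V kp sp) /\
     (forall X : Pregroupoid kp sp, associative X)).
Proof.
move=> ci cii ciii civ cv.
(* The implications run in a cycle from (i) through (v) and back to (i). *)
have i_ii : ci -> cii.
  by case=> S [eS _]; apply: (has_section_comp (F := U3 sp)); exists S.
have ii_iii : cii -> ciii by exact: has_section_comp.
have iii_iv : ciii -> civ by exact: section_V_of_U1.
have iv_v : civ -> cv by exact: extension_of_section_V.
have v_i : cv -> ci.
  move=> hv; apply: bijective_isomorphism; first exact: U123_bijective.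
  exact: U123_fully_faithful.
split; first by do ![split]; auto.
(* The remaining claims are all drawn from (v), reached from (i) along the cycle. *)
move=> /i_ii/ii_iii/iii_iv/iv_v hv; split.
  by apply: bijective_isomorphism; [exact: U12_bijective | exact: U12_fully_faithful].
split.
  by apply: bijective_isomorphism; [exact: U1_bijective | exact: U1_fully_faithful].
split; last exact: extension_associative.
by apply: bijective_isomorphism; [exact: V_bijective | exact: V_fully_faithful].
Qed.
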